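(* Let $R$ be any (associative, not necessarily unital) ring. (i) If $R$ is dense, then $\Lambda(R)$ is an object of $\mathrm{Cu}$, and the assignment $R\mapsto\Lambda(R)$ is continuous when restricted to the class of dense rings. (ii) If $R$ is left normal, then $\mathrm S(R)$ is an object of $\mathrm{Cu}$, and the assignment $R\mapsto \mathrm S(R)$ is continuous when restricted to the class of left normal rings.
   Context: Rings are associative and not necessarily unital. $M_\infty(R)$ is the ring of infinite matrices over $R$ with finitely many nonzero entries. For $x,y\in M_\infty(R)$, $x\precsim_1 y$ means $x=syt$ for some $s,t\in M_\infty(R)$. $x\oplus y$ denotes the infinite matrix represented by the block diagonal matrix $\mathrm{diag}(x,y)$, where $x,y$ are replaced by finite square upper-left corners containing all their nonzero entries. $T(R)=\{(x_n)_{n\ge1}: x_n\in M_\infty(R),\ x_n\precsim_1 x_{n+1}\ \forall n\}$, and $\mathcal S(R)=\{(x_n)\in T(R): \forall n\ \exists y_{n+1}\in M_\infty(R),\ x_n=y_{n+1}x_{n+1}x_n\}$. For $(x_n),(y_n)\in T(R)$ write $(x_n)\precsim(y_n)$ if for every $n$ there is $m$ with $x_n\precsim_1 y_m$, and $(x_n)\sim(y_n)$ if $(x_n)\precsim (y_n)$ and $(y_n)\precsim(x_n)$. Put $\Lambda(R)=T(R)/{\sim}$ and $\mathrm S(R)=\mathcal S(R)/{\sim}\subseteq\Lambda(R)$, with the order induced by $\precsim$ and addition $[(x_n)]+[(y_n)]=[(x_n\oplus y_n)]$; these are positively ordered commutative monoids. A ring homomorphism $\phi\colon R\to R'$ induces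 $\Lambda(\phi)\colon\Lambda(R)\to\Lambda(R')$, $[(x_n)]\mapsto[(\phi(x_n))]$, which restricts to $\mathrm S(\phi)\colon \mathrm S(R)\to\mathrm S(R')$. $R$ is dense if $\precsim_1$ is a dense relation on $M_\infty(R)$: whenever $x\precsim_1 y$ there is $z\in M_\infty(R)$ with $x\precsim_1 z\precsim_1 y$. $R$ is left normal if for all $a,b,c\in M_\infty(R)$ with $a=ba$ and $b=cb$ there exist $d,e\in M_\infty(R)$ with $a=da$, $d=ed$, $e=ce$. In a partially ordered set where increasing sequences have suprema, $x\ll y$ means: for every increasing sequence $(z_n)$ with $y\le\sup_n z_n$ there is $m$ with $x\le z_m$. The category $\mathrm{Cu}$ has as objects the positively ordered monoids $S$ satisfying: (O1) increasing sequences have suprema; (O2) every element is the supremum of a sequence $(x_n)$ with $x_n\ll x_{n+1}$ for all $n$; (O3) $x'\ll x$, $y'\ll y$ imply $x'+y'\ll x+y$; (O4) $\sup_n(x_n+y_n)=\sup_n x_n+\sup_n y_n$ for increasing sequences. Its morphisms are the monoid maps preserving order, $\ll$ and suprema of increasing sequences. $\mathrm{Cu}$ admits direct limits. Continuity means: for every direct system $((R_\lambda)_{\lambda\in\Omega},(\phi_{\mu,\lambda})_{\mu\ge\lambda})$ of rings in the given class, with limit $R=\varinjlim R_\lambda$ in the category of rings and limit maps $\phi_\lambda$, the semigroup $\Lambda(R)$ (resp. $\mathrm S(R)$) together with the maps $\Lambda(\phi_\lambda)$ (resp. $\mathrm S(\phi_\lambda)$) is the direct limit in $\mathrm{Cu}$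 of the induced system of the $\Lambda(R_\lambda)$ (resp. $\mathrm S(R_\lambda)$). *)

(* Defs.v *)
From HB Require Import structures.
From mathcomp Require Import all_boot all_order all_algebra.
From mathcomp Require Import finmap zify.
From mathcomp Require Import boolp classical_sets.

Set Implicit Arguments.
Unset Strict Implicit.
Unset Printing Implicit Defensive.

Import Order.TTheory GRing.Theory.

Local Open Scope ring_scope.
Local Open Scope quotient_scope.

(* Associative rings without a unit: the product is that of [semigroupType],  *)
(* written [(x * y)%g].                                                       *)
HB.mixin Record Zmodule_Semigroup_isRng R of GRing.Zmodule R & Semigroup R := {
  rng_mulDl : forall x y z : R, ((x + y)%R * z)%g = (x * z)%g + (y * z)%g;
  rng_mulDr : forall x y z : R, (x * (y + z)%R)%g = (x * y)%g + (x * z)%g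
}.

#[short(type="rngType")]
HB.structure Definition Rng :=
  { R of GRing.Zmodule R & Semigroup R & Zmodule_Semigroup_isRng R }.

#[short(type="rngMorphism")]
HB.structure Definition RngMorphism (R S : rngType) :=
  { f of @Algebra.isNmodMorphism R S f & @isMultiplicative R S f }.

(* Positively ordered commutative monoids. The order is a separate relation   *)
(* because the joins of MathComp's additive and ordered structures are        *)
(* reserved for groups.                                                       *)
HB.mixin Record Nmodule_isPOMonoid S of GRing.Nmodule S := {
  pom_le : S -> S -> Prop;
  pom_le_refl : forall x, pom_le x x;
  pom_le_anti : forall x y, pom_le x y -> pom_le y x -> x = y;
  pom_le_trans : forall y x z, pom_le x y -> pom_le y z -> pom_le x z;
  pom_le0x : forall x, pom_le 0 x;
  pom_leD : forall x x' y y',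
    pom_le x x' -> pom_le y y' -> pom_le (x + y) (x' + y')
}.

#[short(type="pomType")]
HB.structure Definition POMonoid :=
  { S of GRing.Nmodule S & Nmodule_isPOMonoid S }.

Section RngTheory.
Variable R : rngType.
Implicit Types x y : R.

Lemma rng_mul0l x : ((0 : R) * x)%g = 0.
Proof. by apply: (addIr ((0 : R) * x)%g); rewrite -rng_mulDl !add0r. Qed.

Lemma rng_mul0r x : (x * (0 : R))%g = 0.
Proof. by apply: (addIr (x * (0 : R))%g); rewrite -rng_mulDr !add0r. Qed.

Lemma rng_sumlM (I : Type) (r : seq I) (P : pred I) (F : I -> R) x :
  ((\sum_(i <- r | P i) F i)%R * x)%g = \sum_(i <- r | P i) (F i * x)%g.
Proof.
apply: (big_morph (fun y => (y * x)%g)) => [y z|].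
  exact: rng_mulDl.
exact: rng_mul0l.
Qed.

Lemma rng_sumrM (I : Type) (r : seq I) (P : pred I) (F : I -> R) x :
  (x * (\sum_(i <- r | P i) F i)%R)%g = \sum_(i <- r | P i) (x * F i)%g.
Proof.
apply: (big_morph (fun y => (x * y)%g)) => [y z|].
  exact: rng_mulDr.
exact: rng_mul0r.
Qed.
End RngTheory.

Lemma big_uniq_supp (V : nmodType) (I : eqType) (r1 r2 : seq I) (F : I -> V) :
  uniq r1 -> uniq r2 ->
  (forall i, F i != 0 -> (i \in r1) && (i \in r2)) ->
  \sum_(i <- r1) F i = \sum_(i <- r2) F i.
Proof.
move=> u1 u2 H.
have E r : \sum_(i <- r) F i = \sum_(i <- [seq i <- r | F i != 0]) F i.
  rewrite big_filter [RHS]big_mkcond; apply: eq_bigr => i _.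
  by case: eqP.
rewrite E [RHS]E; apply: perm_big; apply: uniq_perm; rewrite ?filter_uniq //.
move=> i; rewrite !mem_filter.
by case: (boolP (F i != 0)) => //= /H /andP[-> ->].
Qed.

(* Infinite matrices with finitely many nonzero entries; rows and columns are *)
(* indexed from 0.                                                            *)
Definition Minf (R : rngType) := {fsfun nat * nat -> R with 0}.

Section Minf.
Variable R : rngType.
Implicit Types x y z : Minf R.

HB.instance Definition _ := Choice.on (Minf R).

Definition corner_mx (n : nat) (f : nat -> nat -> R) : Minf R :=
  [fsfun p in [fset p | p in allpairs pair (iota 0 n) (iota 0 n)]%fset
     => f p.1 p.2].

(* The least [n] such that all nonzero entries of [x] lie in its upper-left   *)
(* [n x n] corner.                                                            *)
Definition mxsize x : nat := \max_(p <- finsupp x) (maxn p.1.+1 p.2.+1).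

Definition Minf_mul x y : Minf R :=
  corner_mx (maxn (mxsize x) (mxsize y))
    (fun i j => \sum_(0 <= k < mxsize x) (x (i, k) * y (k, j))%g).

Definition oplus x y : Minf R :=
  let n := mxsize x in
  corner_mx (n + mxsize y) (fun i j =>
    if (i < n)%N && (j < n)%N then x (i, j)
    else if (n <= i)%N && (n <= j)%N then y (i - n, j - n)%N
    else 0).

Lemma corner_mxE n f i j :
  corner_mx n f (i, j) = if (i < n)%N && (j < n)%N then f i j else 0.
Proof.
rewrite fsfunE; case: ifP => [|H1]; case: ifP => // H2.
- rewrite !inE => /allpairsP[[a b] /=]; rewrite !mem_iota /= !add0n.
  by move=> -[ha hb [ei ej]]; rewrite ei ej ha hb in H2.
- case/negP: H1; rewrite !inE; apply/allpairsP; exists (i, j) => /=.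
  by rewrite !mem_iota /= !add0n; case/andP: H2.
Qed.

Lemma mxsize_leP x n :
  reflect (forall i j, x (i, j) != 0 -> (i < n)%N && (j < n)%N)
    (mxsize x <= n)%N.
Proof.
apply: (iffP idP) => [le i j nz|H].
  rewrite -geq_max; apply: leq_trans le.
  have xij : (i, j) \in finsupp x by rewrite mem_finsupp.
  rewrite /mxsize (bigD1_seq _ xij) ?fset_uniq //=; exact: leq_maxl.
apply/bigmax_leqP_seq => -[i j]; by rewrite mem_finsupp geq_max => /H.
Qed.

Lemma mxsize_supp x i j : x (i, j) != 0 -> (i < mxsize x)%N && (j < mxsize x)%N.
Proof. exact: (elimT (mxsize_leP _ _) (leqnn _)). Qed.

Lemma mx_out x i j : (mxsize x <= i)%N || (mxsize x <= j)%N -> x (i, j) = 0.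
Proof.
move=> H; apply/eqP; apply: contraTT H => /mxsize_supp.
by rewrite negb_or -!ltnNge.
Qed.

Lemma mxP x y : (forall i j, x (i, j) = y (i, j)) <-> x = y.
Proof. by split=> [H|->//]; apply/fsfunP => -[i j]. Qed.

Lemma Minf_mulEn x y n i j :
  (forall k, (n <= k)%N -> x (i, k) = 0 \/ y (k, j) = 0) ->
  Minf_mul x y (i, j) = \sum_(0 <= k < n) (x (i, k) * y (k, j))%g.
Proof.
move=> H; rewrite corner_mxE.
transitivity (\sum_(0 <= k < mxsize x) (x (i, k) * y (k, j))%g).
  case: ifPn => //; rewrite negb_and -!leqNgt !geq_max => ij.
  rewrite big1 // => k _.
  case/orP: ij => /andP[ix jy].
    by rewrite mx_out ?ix // rng_mul0l.
  by rewrite [X in (_ * X)%g]mx_out ?jy ?orbT // rng_mul0r.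
apply: big_uniq_supp; rewrite ?iota_uniq // => k nz.
rewrite !mem_iota /= !add0n !subn0.
apply/andP; split.
  have /mxsize_supp/andP[] // : x (i, k) != 0.
  by apply: contraNneq nz => ->; rewrite rng_mul0l.
by rewrite ltnNge; apply: contraNN nz => /H[] ->; rewrite ?rng_mul0l ?rng_mul0r.
Qed.

Lemma Minf_mulE x y i j :
  Minf_mul x y (i, j) = \sum_(0 <= k < mxsize x) (x (i, k) * y (k, j))%g.
Proof. by apply: Minf_mulEn => k h; left; apply: mx_out; rewrite h orbT. Qed.

Lemma Minf_mulA : associative Minf_mul.
Proof.
move=> x y z; apply/mxP => i j.
rewrite Minf_mulE [RHS](Minf_mulEn (n := mxsize y)); last first.
  move=> k h; left; rewrite Minf_mulE big1 // => l _.
  by rewrite [X in (_ * X)%g]mx_out ?rng_mul0r // h orbT.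
under eq_bigr => k _ do rewrite Minf_mulE rng_sumrM.
under [RHS]eq_bigr => k _ do rewrite Minf_mulE rng_sumlM.
rewrite exchange_big /=; apply: eq_bigr => k _; apply: eq_bigr => l _.
exact: mulgA.
Qed.

HB.instance Definition _ := isSemigroup.Build (Minf R) Minf_mulA.

Lemma mulMinfEn x y n i j :
  (forall k, (n <= k)%N -> x (i, k) = 0 \/ y (k, j) = 0) ->
  (x * y)%g (i, j) = \sum_(0 <= k < n) (x (i, k) * y (k, j))%g.
Proof. exact: Minf_mulEn. Qed.

Definition precsim1 x y : Prop := exists s t : Minf R, x = (s * y * t)%g.

Lemma precsim1_trans y x z : precsim1 x y -> precsim1 y z -> precsim1 x z.
Proof.
move=> [s [t ->]] [s' [t' ->]]; exists (s * s')%g, (t' * t)%g.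
by rewrite !mulgA.
Qed.

Definition Minf0 : Minf R := [fsfun].

Lemma Minf0E i j : Minf0 (i, j) = 0.
Proof. by rewrite fsfunE. Qed.

Lemma mxsize0 : mxsize Minf0 = 0%N.
Proof.
by apply/eqP; rewrite -leqn0; apply/mxsize_leP => i j; rewrite Minf0E eqxx.
Qed.

Lemma precsim10 x : precsim1 Minf0 x.
Proof.
exists Minf0, Minf0; apply/mxP => i j.
rewrite Minf0E (mulMinfEn (n := 0)) ?big_geq //.
by move=> k _; right; rewrite Minf0E.
Qed.

End Minf.

Section Blocks.
Variable R : rngType.
Implicit Types (x y z A B : Minf R) (d : nat -> nat + nat).

(* The two-block matrix whose indices are sorted into the two blocks by [d1]  *)
(* (rows) and [d2] (columns).                                                 *)
Definition block2 d1 d2 x y (i j : nat) : R :=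
  match d1 i, d2 j with
  | inl a, inl b => x (a, b)
  | inr a, inr b => y (a, b)
  | _, _ => 0
  end.

Definition covers d (N m n : nat) : Prop :=
  (forall a, (a < m)%N -> exists2 k, (k < N)%N & d k = inl a) /\
  (forall a, (a < n)%N -> exists2 k, (k < N)%N & d k = inr a).

Lemma block2_sum d1 d d2 N m n x y x' y' i j :
  injective d -> covers d N m n ->
  (forall i j k, (m <= k)%N -> x (i, k) = 0 \/ x' (k, j) = 0) ->
  (forall i j k, (n <= k)%N -> y (i, k) = 0 \/ y' (k, j) = 0) ->
  \sum_(0 <= k < N) (block2 d1 d x y i k * block2 d d2 x' y' k j)%g
  = block2 d1 d2 (x * x')%g (y * y')%g i j.
Proof.
move=> injd [cl cr] Hx Hy; rewrite /block2.
case: (d1 i) => a; case: (d2 j) => b.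
- rewrite (mulMinfEn (n := m)); last by move=> k /(Hx a b).
  pose H (u : nat + nat) : R :=
    match u with inl c => (x (a, c) * x' (c, b))%g | inr c => 0 end.
  transitivity (\sum_(u <- map d (index_iota 0 N)) H u).
    rewrite big_map; apply: eq_bigr => k _.
    by case: (d k) => c //=; rewrite rng_mul0l.
  transitivity (\sum_(u <- map (@inl nat nat) (index_iota 0 m)) H u);
    last first.
    by rewrite big_map.
  apply: big_uniq_supp; rewrite ?map_inj_uniq ?iota_uniq //.
    by move=> ? ? [].
  case=> c /=; last by rewrite eqxx.
  move=> nz; have cm : (c < m)%N.
    rewrite ltnNge; apply: contraNN nz => /(Hx a b)[] ->.
      by rewrite rng_mul0l.
    by rewrite rng_mul0r.
  apply/andP; split; last by apply: map_f; rewrite mem_index_iota.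
  by have [k kN <-] := cl c cm; apply: map_f; rewrite mem_index_iota.
- by rewrite big1 // => k _; case: (d k) => c; rewrite ?rng_mul0l ?rng_mul0r.
- by rewrite big1 // => k _; case: (d k) => c; rewrite ?rng_mul0l ?rng_mul0r.
- rewrite (mulMinfEn (n := n)); last by move=> k /(Hy a b).
  pose H (u : nat + nat) : R :=
    match u with inr c => (y (a, c) * y' (c, b))%g | inl c => 0 end.
  transitivity (\sum_(u <- map d (index_iota 0 N)) H u).
    rewrite big_map; apply: eq_bigr => k _.
    by case: (d k) => c //=; rewrite rng_mul0l.
  transitivity (\sum_(u <- map (@inr nat nat) (index_iota 0 n)) H u);
    last first.
    by rewrite big_map.
  apply: big_uniq_supp; rewrite ?map_inj_uniq ?iota_uniq //.
    by move=> ? ? [].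
  case=> c /=; first by rewrite eqxx.
  move=> nz; have cm : (c < n)%N.
    rewrite ltnNge; apply: contraNN nz => /(Hy a b)[] ->.
      by rewrite rng_mul0l.
    by rewrite rng_mul0r.
  apply/andP; split; last by apply: map_f; rewrite mem_index_iota.
  by have [k kN <-] := cr c cm; apply: map_f; rewrite mem_index_iota.
Qed.

Lemma coversW d N N' m n : (N <= N')%N -> covers d N m n -> covers d N' m n.
Proof.
move=> le [cl cr]; split=> a.
  by move=> /cl[k kN dk]; exists k => //; apply: leq_trans le.
by move=> /cr[k kN dk]; exists k => //; apply: leq_trans le.
Qed.

Lemma mx_outr x m i k : (mxsize x <= m)%N -> (m <= k)%N -> x (i, k) = 0.
Proof. by move=> h1 h2; apply: mx_out; rewrite (leq_trans h1 h2) orbT. Qed.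

Lemma mx_outl x m i k : (mxsize x <= m)%N -> (m <= k)%N -> x (k, i) = 0.
Proof. by move=> h1 h2; apply: mx_out; rewrite (leq_trans h1 h2). Qed.

Lemma block2_precsim1 d d' N A B x y x' y' :
  (forall i j, A (i, j) = block2 d d x y i j) ->
  (forall i j, B (i, j) = block2 d' d' x' y' i j) ->
  injective d' -> covers d' N (mxsize x') (mxsize y') ->
  precsim1 x x' -> precsim1 y y' -> precsim1 A B.
Proof.
move=> EA EB injd cov [s [t ex]] [s' [t' ey]].
pose n := maxn N (maxn (mxsize A) (mxsize B)).
have {}cov : covers d' n (mxsize x') (mxsize y').
  by apply: coversW cov; rewrite leq_maxl.
have nA : (mxsize A <= n)%N by rewrite /n; lia.
pose S := corner_mx n (block2 d d' s s').
pose T := corner_mx n (block2 d' d t t').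
have SE i k : S (i, k) =
  if (i < n)%N && (k < n)%N then block2 d d' s s' i k else 0.
  exact: corner_mxE.
have TE i k : T (i, k) =
  if (i < n)%N && (k < n)%N then block2 d' d t t' i k else 0.
  exact: corner_mxE.
have S0 i k : (n <= i)%N || (n <= k)%N -> S (i, k) = 0.
  by rewrite SE; case: ifP => //; lia.
have T0 i k : (n <= i)%N || (n <= k)%N -> T (i, k) = 0.
  by rewrite TE; case: ifP => //; lia.
have SBE i k : (i < n)%N ->
  (S * B)%g (i, k) = block2 d d' (s * x')%g (s' * y')%g i k.
  move=> lin; rewrite (mulMinfEn (n := n)); last first.
    by move=> l h; left; rewrite S0 ?h ?orbT.
  rewrite -(block2_sum d d' _ _ injd cov).
  - apply: eq_big_nat => l /andP[_ ln]; by rewrite SE lin ln EB.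
  - by move=> ? ? l h; right; apply: mx_outl h.
  - by move=> ? ? l h; right; apply: mx_outl h.
have prodr u x0 m i k : (mxsize x0 <= m)%N -> (m <= k)%N ->
  (u * x0 : Minf R)%g (i, k) = 0.
  move=> h1 h2; rewrite (mulMinfEn (n := 0)) ?big_geq // => l _; right.
  exact: mx_outr h1 h2.
exists S, T; apply/mxP => i j.
have [lin|nli] := ltnP i n; last first.
  rewrite (mx_outl _ nA nli) (mulMinfEn (n := 0)) ?big_geq // => k _; left.
  by rewrite (mulMinfEn (n := 0)) ?big_geq // => l _; left; rewrite S0 ?nli.
have [ljn|nlj] := ltnP j n; last first.
  rewrite (mx_outr _ nA nlj) (mulMinfEn (n := 0)) ?big_geq // => k _; right.
  by rewrite T0 ?nlj ?orbT.
rewrite EA ex ey (mulMinfEn (n := n)); last by move=> k h; right; rewrite T0 ?h.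
rewrite -(block2_sum d d _ _ injd cov).
- by apply: eq_big_nat => k /andP[_ kn]; rewrite SBE // TE kn ljn.
- by move=> ? ? l h; left; apply: prodr h.
- by move=> ? ? l h; left; apply: prodr h.
Qed.

Definition dsplit (n i : nat) : nat + nat :=
  if (i < n)%N then inl i else inr (i - n)%N.

Lemma dsplit_inj n : injective (dsplit n).
Proof.
by move=> i j; rewrite /dsplit; do 2!case: ltnP => ?; move=> // -[]; lia.
Qed.

Lemma dsplit_covers m n : covers (dsplit m) (m + n) m n.
Proof.
split=> a h.
  by exists a; [lia | rewrite /dsplit h].
by exists (m + a)%N; [lia | rewrite /dsplit ltnNge leq_addr /= addKn].
Qed.

Lemma oplusE x y i j :
  oplus x y (i, j) = block2 (dsplit (mxsize x)) (dsplit (mxsize x)) x y i j.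
Proof.
rewrite corner_mxE /block2 /dsplit.
case: (ltnP i (mxsize x)) => hi; case: (ltnP j (mxsize x)) => hj;
  rewrite /= ?if_same //.
  by rewrite !ltn_addr.
case: ifP => // h; rewrite mx_out //; lia.
Qed.

Lemma oplus_precsim1 x x' y y' :
  precsim1 x x' -> precsim1 y y' -> precsim1 (oplus x y) (oplus x' y').
Proof.
apply: block2_precsim1; [exact: oplusE|exact: oplusE|exact: dsplit_inj|].
exact: dsplit_covers.
Qed.

Lemma oplusC_precsim1 x x' y y' :
  precsim1 x x' -> precsim1 y y' -> precsim1 (oplus x y) (oplus y' x').
Proof.
pose sw (u : nat + nat) : nat + nat :=
  match u with inl a => inr a | inr a => inl a end.
have swi : injective sw by do 2!case=> ?; move=> // -[->].
apply: (@block2_precsim1 _ (sw \o dsplit (mxsize y')) (mxsize y' + mxsize x')).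
- exact: oplusE.
- by move=> i j; rewrite oplusE /block2 /=; do 2!case: (dsplit _ _).
- by apply: inj_comp => //; exact: dsplit_inj.
- have [cl cr] := dsplit_covers (mxsize y') (mxsize x'); split=> a.
    by move=> /cr[k kN dk]; exists k => //=; rewrite dk.
  by move=> /cl[k kN dk]; exists k => //=; rewrite dk.
Qed.

Lemma oplus0m x : oplus (Minf0 R) x = x.
Proof.
apply/mxP => i j; rewrite oplusE /block2 /dsplit mxsize0 !ltn0.
by rewrite !subn0.
Qed.

Lemma oplusm0 x : oplus x (Minf0 R) = x.
Proof.
apply/mxP => i j; rewrite oplusE /block2 /dsplit.
by do 2!case: ltnP => ? //; rewrite ?Minf0E mx_out //; lia.
Qed.

Lemma mxsize_oplus x y : mxsize (oplus x y) = (mxsize x + mxsize y)%N.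
Proof.
apply/eqP; rewrite eqn_leq; apply/andP; split.
  apply/mxsize_leP => i j; rewrite corner_mxE.
  by case: ifP => //; rewrite eqxx.
have [y0|ypos] := posnP (mxsize y).
  rewrite y0 addn0; apply/mxsize_leP => i j nz.
  have := mxsize_supp nz => /andP[hi hj].
  apply: mxsize_supp.
  by rewrite oplusE /block2 /dsplit hi hj.
have xle : (mxsize x <= mxsize (oplus x y))%N.
  apply/mxsize_leP => i j nz.
  have := mxsize_supp nz => /andP[hi hj].
  apply: mxsize_supp.
  by rewrite oplusE /block2 /dsplit hi hj.
have : (mxsize y <= mxsize (oplus x y) - mxsize x)%N; last lia.
apply/mxsize_leP => i j nz.
have : oplus x y (mxsize x + i, mxsize x + j)%N != 0.
  by rewrite oplusE /block2 /dsplit !ltnNge !leq_addr /= !addKn.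
move/mxsize_supp; lia.
Qed.

Lemma oplusA : associative (@oplus R).
Proof.
have E (u v : Minf R) (i j : nat) : oplus u v (i, j) =
    if (i < mxsize u)%N && (j < mxsize u)%N then u (i, j)
    else if (mxsize u <= i)%N && (mxsize u <= j)%N
    then v (i - mxsize u, j - mxsize u)%N else 0.
  rewrite oplusE /block2 /dsplit.
  by case: (ltnP i (mxsize u)) => hi; case: (ltnP j (mxsize u)).
move=> x y z; apply/mxP => i j; rewrite !E mxsize_oplus.
repeat case: ifP => ? //; rewrite ?subnDA //; lia.
Qed.

Definition dparity (i : nat) : nat + nat :=
  if odd i then inr i./2 else inl i./2.

Lemma dparity_inj : injective dparity.
Proof.
by move=> i j; rewrite /dparity; case: ifP; case: ifP => // ? ? []; lia.
Qed.

Lemma dparity_covers m n : covers dparity (2 * maxn m n) m n.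
Proof.
split=> a h.
  by exists a.*2; [lia | rewrite /dparity odd_double doubleK].
by exists a.*2.+1; [lia | rewrite /dparity /= odd_double /= uphalf_double].
Qed.

Definition interleave x y : Minf R :=
  corner_mx (2 * maxn (mxsize x) (mxsize y)) (block2 dparity dparity x y).

Lemma interleaveE x y i j :
  interleave x y (i, j) = block2 dparity dparity x y i j.
Proof.
rewrite corner_mxE; case: ifP => // h; rewrite /block2 /dparity.
by case: ifP => hi; case: ifP => hj //; rewrite mx_out //; lia.
Qed.

Lemma interleaveM x y x' y' :
  interleave (x * x')%g (y * y')%g = (interleave x y * interleave x' y')%g.
Proof.
apply/mxP => i j; rewrite interleaveE.
rewrite (mulMinfEn (n := (2 * maxn (mxsize x) (mxsize y))%N)); last first.
  move=> k h; left; rewrite corner_mxE; case: ifP => //; lia.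
have cov := dparity_covers (mxsize x) (mxsize y).
rewrite -(block2_sum _ _ _ _ dparity_inj cov).
- by apply: eq_big_nat => k _; rewrite !interleaveE.
- by move=> ? ? k h; left; apply: mx_outr h.
- by move=> ? ? k h; left; apply: mx_outr h.
Qed.

Lemma interleave_precsim1 x x' y y' :
  precsim1 x x' -> precsim1 y y' ->
  precsim1 (interleave x y) (interleave x' y').
Proof.
apply: block2_precsim1; [exact: interleaveE|exact: interleaveE|
  exact: dparity_inj|].
exact: dparity_covers.
Qed.

Lemma oplus_interleave x x' y y' :
  precsim1 x x' -> precsim1 y y' -> precsim1 (oplus x y) (interleave x' y').
Proof.
apply: block2_precsim1; [exact: oplusE|exact: interleaveE|
  exact: dparity_inj|].
exact: dparity_covers.
Qed.

Lemma interleave_oplus x x' y y' :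
  precsim1 x x' -> precsim1 y y' -> precsim1 (interleave x y) (oplus x' y').
Proof.
apply: block2_precsim1; [exact: interleaveE|exact: oplusE|exact: dsplit_inj|].
exact: dsplit_covers.
Qed.

End Blocks.

Section Functoriality.
Variables (R R' : rngType) (phi : rngMorphism R R').

Definition Minf_map (x : Minf R) : Minf R' :=
  [fsfun p in finsupp x => phi (x p)].

Lemma Minf_mapE x p : Minf_map x p = phi (x p).
Proof.
rewrite fsfunE; case: ifPn => //; rewrite mem_finsupp negbK => /eqP ->.
by rewrite raddf0.
Qed.

Lemma Minf_mapM x y : Minf_map (x * y)%g = (Minf_map x * Minf_map y)%g.
Proof.
apply/mxP => i j; rewrite Minf_mapE !(mulMinfEn (n := mxsize x)); last first.
- by move=> k h; left; apply: mx_out; rewrite h orbT.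
- move=> k h; left; rewrite Minf_mapE (_ : x (i, k) = 0) ?raddf0 //.
  by apply: mx_out; rewrite h orbT.
rewrite raddf_sum; apply: eq_bigr => k _.
by rewrite !Minf_mapE gmulfM.
Qed.

Lemma precsim1_map x y : precsim1 x y -> precsim1 (Minf_map x) (Minf_map y).
Proof.
by move=> [s [t ->]]; exists (Minf_map s), (Minf_map t); rewrite !Minf_mapM.
Qed.
End Functoriality.

(* Sequences are indexed from 0.                                              *)
Record Tseq (R : rngType) := MkTseq {
  tseq :> nat -> Minf R;
  tseqP : forall n, precsim1 (tseq n) (tseq n.+1)
}.

HB.instance Definition _ (R : rngType) := gen_eqMixin (Tseq R).
HB.instance Definition _ (R : rngType) := gen_choiceMixin (Tseq R).

(* Membership in the subset of [T(R)] denoted by a calligraphic S.            *)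
Definition in_calS (R : rngType) (x : Tseq R) : Prop :=
  forall n, exists y : Minf R, x n = (y * x n.+1 * x n)%g.

Section Lambda.
Variable R : rngType.
Implicit Types x y z : Tseq R.

Definition precsim x y : Prop := forall n, exists m, precsim1 (x n) (y m).

Lemma precsim_refl x : precsim x x.
Proof. by move=> n; exists n.+1; apply: tseqP. Qed.

Lemma precsim_trans y x z : precsim x y -> precsim y z -> precsim x z.
Proof.
move=> xy yz n; have [m h] := xy n; have [k h'] := yz m.
by exists k; apply: precsim1_trans h h'.
Qed.

Definition tsim : rel (Tseq R) := fun x y => `[< precsim x y /\ precsim y x >].

Lemma tsim_refl : reflexive tsim.
Proof. by move=> x; apply/asboolP; split; apply: precsim_refl. Qed.

Lemma tsim_sym : symmetric tsim.
Proof. by move=> x y; apply/asboolP/asboolP => -[]. Qed.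

Lemma tsim_trans : transitive tsim.
Proof.
move=> y x z /asboolP[xy yx] /asboolP[yz zy]; apply/asboolP.
by split; [apply: precsim_trans xy yz | apply: precsim_trans zy yx].
Qed.

Canonical tsim_equiv := EquivRel tsim tsim_refl tsim_sym tsim_trans.

Definition Lambda := {eq_quot tsim_equiv}.

HB.instance Definition _ := Choice.on Lambda.
HB.instance Definition _ := EqQuotient.on Lambda.

Lemma Lambda_eqP x y :
  \pi_Lambda x = \pi_Lambda y <-> precsim x y /\ precsim y x.
Proof. by split=> [/eqmodP/asboolP|h]//; apply/eqmodP/asboolP. Qed.

Lemma Lambda_repr x :
  precsim x (repr (\pi_Lambda x)) /\ precsim (repr (\pi_Lambda x)) x.
Proof. by apply/Lambda_eqP; rewrite reprK. Qed.

Definition Toplus x y : Tseq R :=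
  MkTseq (fun n => oplus_precsim1 (tseqP x n) (tseqP y n)).

Definition Tzero : Tseq R := MkTseq (fun n : nat => precsim10 (Minf0 R)).

Lemma tseq_homo x m n : (m < n)%N -> precsim1 (x m) (x n).
Proof.
elim: n => // n IH; rewrite ltnS leq_eqVlt => /orP[/eqP->|/IH h].
  exact: tseqP.
exact: precsim1_trans h (tseqP x n).
Qed.

Lemma precsim_pair (u v : nat -> Minf R) x y :
  (forall n, exists m, precsim1 (u n) (x m)) ->
  (forall n, exists m, precsim1 (v n) (y m)) ->
  forall n, exists m, precsim1 (u n) (x m) /\ precsim1 (v n) (y m).
Proof.
move=> ux vy n; have [m h] := ux n; have [k h'] := vy n.
exists (maxn m k).+1; split.
  by apply: precsim1_trans h _; apply: tseq_homo; rewrite ltnS leq_maxl.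
by apply: precsim1_trans h' _; apply: tseq_homo; rewrite ltnS leq_maxr.
Qed.

Lemma Toplus_precsim x x' y y' :
  precsim x x' -> precsim y y' -> precsim (Toplus x y) (Toplus x' y').
Proof.
move=> hx hy n; have [m [h h']] := @precsim_pair x y _ _ hx hy n.
by exists m; apply: oplus_precsim1.
Qed.

Definition Lambda_le (a b : Lambda) : Prop := precsim (repr a) (repr b).
Definition Lambda_add (a b : Lambda) : Lambda :=
  \pi_Lambda (Toplus (repr a) (repr b)).
Definition Lambda_zero : Lambda := \pi_Lambda Tzero.

Lemma Lambda_lePi x y : Lambda_le (\pi_Lambda x) (\pi_Lambda y) <-> precsim x y.
Proof.
have [h1 h2] := Lambda_repr x; have [h3 h4] := Lambda_repr y.
split=> h; first exact: precsim_trans h1 (precsim_trans h h4).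
exact: precsim_trans h2 (precsim_trans h h3).
Qed.

Lemma Lambda_addPi x y :
  Lambda_add (\pi_Lambda x) (\pi_Lambda y) = \pi_Lambda (Toplus x y).
Proof.
apply/Lambda_eqP; have [h1 h2] := Lambda_repr x; have [h3 h4] := Lambda_repr y.
by split; apply: Toplus_precsim.
Qed.

Lemma Lambda_addA : associative Lambda_add.
Proof.
elim/quotW=> x; elim/quotW=> y; elim/quotW=> z.
rewrite (Lambda_addPi y z) (Lambda_addPi x (Toplus y z)).
rewrite (Lambda_addPi x y) (Lambda_addPi (Toplus x y) z).
apply/Lambda_eqP.
by split=> n; exists n.+1; rewrite /= oplusA; do !apply: oplus_precsim1;
  apply: tseqP.
Qed.

Lemma Lambda_addC : commutative Lambda_add.
Proof.
elim/quotW=> x; elim/quotW=> y.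
rewrite (Lambda_addPi x y) (Lambda_addPi y x); apply/Lambda_eqP.
by split=> n; exists n.+1; apply: oplusC_precsim1; apply: tseqP.
Qed.

Lemma Lambda_add0 : left_id Lambda_zero Lambda_add.
Proof.
elim/quotW=> x; rewrite (Lambda_addPi Tzero x); apply/Lambda_eqP.
by split=> n; exists n.+1; rewrite /= oplus0m; apply: tseqP.
Qed.

HB.instance Definition _ :=
  GRing.isNmodule.Build Lambda Lambda_addA Lambda_addC Lambda_add0.

Lemma Lambda_le_refl a : Lambda_le a a.
Proof. exact: precsim_refl. Qed.

Lemma Lambda_le_anti a b : Lambda_le a b -> Lambda_le b a -> a = b.
Proof. by move=> ab ba; rewrite -[a]reprK -[b]reprK; apply/Lambda_eqP. Qed.

Lemma Lambda_le_trans b a c : Lambda_le a b -> Lambda_le b c -> Lambda_le a c.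
Proof. exact: precsim_trans. Qed.

Lemma Lambda_le0x a : Lambda_le 0 a.
Proof.
elim/quotW: a => x; apply/Lambda_lePi => n; exists 0%N; exact: precsim10.
Qed.

Lemma Lambda_leD (a a' b b' : Lambda) :
  Lambda_le a a' -> Lambda_le b b' -> Lambda_le (a + b) (a' + b').
Proof. by move=> ha hb; apply/Lambda_lePi; apply: Toplus_precsim. Qed.

HB.instance Definition _ := Nmodule_isPOMonoid.Build Lambda
  Lambda_le_refl Lambda_le_anti Lambda_le_trans Lambda_le0x Lambda_leD.

(* The classes in [Lambda] with a representative in [in_calS]; they form      *)
(* S(R), defined below as [Ssemi].                                            *)
Definition Sclass : {pred Lambda} :=
  [pred a | `[< exists2 x : Tseq R, in_calS x & a = \pi_Lambda x >]].

Definition Tinterleave x y : Tseq R :=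
  MkTseq (fun n => interleave_precsim1 (tseqP x n) (tseqP y n)).

(* [Toplus] itself need not preserve [in_calS], since the sizes of the        *)
(* corners vary along the sequences; [Tinterleave] does, and has the same     *)
(* class.                                                                     *)
Lemma Toplus_interleave x y :
  \pi_Lambda (Toplus x y) = \pi_Lambda (Tinterleave x y).
Proof.
apply/Lambda_eqP; split=> n; exists n.+1.
  by apply: oplus_interleave; apply: tseqP.
by apply: interleave_oplus; apply: tseqP.
Qed.

Lemma Sclass_addr_closed : Algebra.addumagma_closed Sclass.
Proof.
split.
  apply/asboolP; exists Tzero => // n; exists (Minf0 R).
  apply/mxP => i j; rewrite Minf0E (mulMinfEn (n := 0)) ?big_geq // => k _.
  by right; rewrite Minf0E.
move=> a b /asboolP[x Sx ->] /asboolP[y Sy ->]; apply/asboolP.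
exists (Tinterleave x y).
  move=> n; have [u ex] := Sx n; have [v ey] := Sy n.
  by exists (interleave u v); rewrite -!interleaveM -ex -ey.
by rewrite -Toplus_interleave -Lambda_addPi.
Qed.

Record Ssemi := MkSsemi { Sval :> Lambda; SvalP : Sclass Sval }.

HB.instance Definition _ := [isSub for Sval].
HB.instance Definition _ := [Choice of Ssemi by <:].
HB.instance Definition _ :=
  GRing.SubChoice_isSubNmodule.Build Lambda Sclass Ssemi Sclass_addr_closed.

Definition Ssemi_le (a b : Ssemi) : Prop := pom_le (Sval a) (Sval b).

Lemma Ssemi_le_refl a : Ssemi_le a a.
Proof. exact: pom_le_refl. Qed.

Lemma Ssemi_le_anti a b : Ssemi_le a b -> Ssemi_le b a -> a = b.
Proof. by move=> ab ba; apply: val_inj; apply: pom_le_anti. Qed.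

Lemma Ssemi_le_trans b a c : Ssemi_le a b -> Ssemi_le b c -> Ssemi_le a c.
Proof. exact: pom_le_trans. Qed.

Lemma Ssemi_le0x a : Ssemi_le 0 a.
Proof. exact: pom_le0x. Qed.

Lemma Ssemi_leD (a a' b b' : Ssemi) :
  Ssemi_le a a' -> Ssemi_le b b' -> Ssemi_le (a + b) (a' + b').
Proof. exact: pom_leD. Qed.

HB.instance Definition _ := Nmodule_isPOMonoid.Build Ssemi
  Ssemi_le_refl Ssemi_le_anti Ssemi_le_trans Ssemi_le0x Ssemi_leD.

End Lambda.

Section InducedMaps.
Variables (R R' : rngType) (phi : rngMorphism R R').

Definition Tmap (x : Tseq R) : Tseq R' :=
  MkTseq (fun n => precsim1_map phi (tseqP x n)).

Definition Lambda_map (a : Lambda R) : Lambda R' :=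
  \pi_(Lambda R') (Tmap (repr a)).

Lemma Lambda_mapPi x : Lambda_map (\pi_(Lambda R) x) = \pi_(Lambda R') (Tmap x).
Proof.
apply/Lambda_eqP; have [h1 h2] := Lambda_repr x.
split=> n; [have [m h] := h2 n | have [m h] := h1 n].
all: by exists m; apply: precsim1_map.
Qed.

Lemma Lambda_map_Sclass a : Sclass a -> Sclass (Lambda_map a).
Proof.
move=> /asboolP[x Sx ->]; apply/asboolP; exists (Tmap x);
  last exact: Lambda_mapPi.
move=> n; have [y e] := Sx n; exists (Minf_map phi y).
by rewrite /= -!Minf_mapM -e.
Qed.

Definition Ssemi_map (a : Ssemi R) : Ssemi R' :=
  MkSsemi (Lambda_map_Sclass (SvalP a)).
End InducedMaps.

Definition dense_rng (R : rngType) : Prop :=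
  forall x y : Minf R, precsim1 x y ->
    exists z : Minf R, precsim1 x z /\ precsim1 z y.

Definition left_normal (R : rngType) : Prop :=
  forall a b c : Minf R, a = (b * a)%g -> b = (c * b)%g ->
    exists d e : Minf R, [/\ a = (d * a)%g, d = (e * d)%g & e = (c * e)%g].

Section CuntzCategory.
Variable S : pomType.
Implicit Types (x y z s t : S) (u v : nat -> S).

Definition increasing u : Prop := forall n, pom_le (u n) (u n.+1).

Definition is_sup u s : Prop :=
  (forall n, pom_le (u n) s) /\
  (forall t, (forall n, pom_le (u n) t) -> pom_le s t).

Definition way_below x y : Prop :=
  forall u s, increasing u -> is_sup u s -> pom_le y s ->
    exists m, pom_le x (u m).

Record is_Cu : Prop := IsCu {
  Cu_O1 : forall u, increasing u -> exists s, is_sup u s;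
  Cu_O2 : forall x, exists2 u,
    (forall n, way_below (u n) (u n.+1)) & is_sup u x;
  Cu_O3 : forall x' x y' y,
    way_below x' x -> way_below y' y -> way_below (x' + y') (x + y);
  Cu_O4 : forall u v s t, increasing u -> increasing v ->
    is_sup u s -> is_sup v t -> is_sup (fun n => u n + v n) (s + t)
}.
End CuntzCategory.

Record is_Cu_morphism (S T : pomType) (f : S -> T) : Prop := IsCuMorphism {
  Cu_morphD : nmod_morphism f;
  Cu_morph_le : forall x y, pom_le x y -> pom_le (f x) (f y);
  Cu_morph_way_below : forall x y, way_below x y -> way_below (f x) (f y);
  Cu_morph_sup : forall u s, increasing u -> is_sup u s ->
    is_sup (fun n => f (u n)) (f s)
}.

Definition is_rng_morphism (R S : rngType) (f : R -> S) : Prop :=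
  nmod_morphism f /\ {morph f : x y / (x * y)%g}.

(* Categories of structured sets, given by the structures, their underlying   *)
(* sets, and the structures and maps that count as objects and morphisms.     *)
Record concrete_category := ConcreteCategory {
  structure : Type;
  carrier : structure -> Type;
  is_object : structure -> Prop;
  is_morphism : forall A B : structure, (carrier A -> carrier B) -> Prop
}.

Definition rng_category : concrete_category :=
  @ConcreteCategory rngType Rng.sort (fun _ => True) is_rng_morphism.

Definition Cu_category : concrete_category :=
  @ConcreteCategory pomType POMonoid.sort is_Cu is_Cu_morphism.

Section DirectLimits.
Variables (C : concrete_category) (disp : Order.disp_t) (I : preorderType disp).

Definition directed : Prop :=
  inhabited I /\ forall i j : I, exists k : I, (i <= k)%O && (j <= k)%O.

Variables (X : I -> structure C).
Variable f : forall i j : I, (i <= j)%O -> carrier (X i) -> carrier (X j).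

Record is_direct_system : Prop := IsDirectSystem {
  dsys_object : forall i, is_object (X i);
  dsys_morphism : forall i j (ij : (i <= j)%O), is_morphism (f ij);
  dsys_id : forall i (ii : (i <= i)%O) x, f ii x = x;
  dsys_comp : forall i j k (ij : (i <= j)%O) (jk : (j <= k)%O)
    (ik : (i <= k)%O) x, f jk (f ij x) = f ik x
}.

Record is_cocone (L : structure C)
    (p : forall i, carrier (X i) -> carrier L) : Prop := IsCocone {
    cocone_object : is_object L;
    cocone_morphism : forall i, is_morphism (p i);
    cocone_comp : forall i j (ij : (i <= j)%O) x, p j (f ij x) = p i x
  }.

Definition is_direct_limit (L : structure C)
    (p : forall i, carrier (X i) -> carrier L) : Prop :=
  is_cocone p /\
  forall (Y : structure C) (g : forall i, carrier (X i) -> carrier Y),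
    is_cocone g ->
    exists h : carrier L -> carrier Y,
      [/\ is_morphism h, (forall i x, h (p i x) = g i x) &
          forall h' : carrier L -> carrier Y, is_morphism h' ->
            (forall i x, h' (p i x) = g i x) -> h' =1 h].
End DirectLimits.

(* [F], with action [Fmap] on ring morphisms, sends direct limits of rings    *)
(* over directed systems in the class [P] to direct limits in Cu.             *)
Definition continuous_on (P : rngType -> Prop) (F : rngType -> pomType)
    (Fmap : forall R R' : rngType, rngMorphism R R' -> F R -> F R') : Prop :=
  forall (disp : Order.disp_t) (I : preorderType disp) (X : I -> rngType)
    (f : forall i j : I, (i <= j)%O -> rngMorphism (X i) (X j))
    (L : rngType) (p : forall i, rngMorphism (X i) L),
    directed I ->
    (forall i, P (X i)) ->
    @is_direct_system rng_category disp I X f ->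
    @is_direct_limit rng_category disp I X f L p ->
    @is_direct_system Cu_category disp I (fun i => F (X i))
      (fun i j ij => Fmap _ _ (f i j ij)) /\
    @is_direct_limit Cu_category disp I (fun i => F (X i))
      (fun i j ij => Fmap _ _ (f i j ij)) (F L) (fun i => Fmap _ _ (p i)).

Arguments continuous_on P F Fmap : clear implicits.

(* Main.v *)
From HB Require Import structures.
Require Import Defs.
From mathcomp Require Import all_boot all_order all_algebra.
From mathcomp Require Import finmap boolp.

(** Write [a] below [b] for [precsim1 a b]. Sequences in T(R) up to
equivalence are the countably generated rounded ideals of this transitive
relation, a sequence [x] giving the set of all matrices below some [x n]. The
order becomes inclusion, and increasing sequences have unions as suprema. If
the relation interpolates, then [x] is way below [y] exactly when all terms of
[x] lie below one term of [y] ([way_belowP]): interpolation puts between [y n]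
and [y n.+1] a whole sequence, so that [y] is the supremum of elements each
bounded by a term of [y]. The axioms of Cu follow from this description
([represents_is_Cu]).

The subsemigroup S(R) is treated in the same way. Its elements are the classes
of the chains for the relation [unital_below], [a = y b a], as those of
Lambda(R) are the classes of the chains for [precsim1]; each of these two
relations will be called a link. What is required of a link is that its chains
are closed under suprema of increasing sequences, and that for consecutive
links [a], [b], [c] some chain lies above [a] and below [c]. The first is free
for [precsim1]; for [unital_below] the representative of a supremum must be
changed ([tsup_unital]). The second is density for [precsim1], and for
[unital_below] it is obtained by applying left normality repeatedly
([left_normal_interpolation]).

For continuity, a direct limit of rings is compared with the explicit colimit
of germs: every element of the limit comes from some stage, and two elements of
one stage with the same image become equal at a later stage ([limit_onto],
[limit_eq]). Finite matrices, and finitely many equations between them, inherit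
this. Hence a chain over the limit lifts term by term to chain links over later
and later stages; the interpolating chains at these stages exhibit each element
of the limit semigroup as a supremum of images of elements [z n] with [z n] way
below [z n.+1] after transition ([Fmap_approx_exists]), and an inequality in
the limit holds at some stage once its left side is replaced by an element way
below it ([Fmap_limit_le]). These two properties characterise direct limits in
Cu ([Cu_direct_limit]): the map out of the limit sends such a supremum to the
supremum of the images of the [z n]. *)

Set Implicit Arguments.
Unset Strict Implicit.
Unset Printing Implicit Defensive.

Import Order.TTheory GRing.Theory.

Local Open Scope ring_scope.
Local Open Scope quotient_scope.

(** * Direct limits of rings *)

Section RingColimit.
Variables (disp : Order.disp_t) (I : preorderType disp) (X : I -> rngType).
Variable f : forall i j : I, (i <= j)%O -> rngMorphism (X i) (X j).
Hypothesis dirI : directed I.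
Hypothesis sysX : @is_direct_system rng_category disp I X f.

Let fid i (ii : (i <= i)%O) (x : X i) : f ii x = x.
Proof. exact: (dsys_id sysX). Qed.

Let fcomp i j k (ij : (i <= j)%O) (jk : (j <= k)%O) (ik : (i <= k)%O)
  (x : X i) : f jk (f ij x) = f ik x.
Proof. exact: (dsys_comp sysX). Qed.

(** Two elements of stages have the same germ if they become equal at a later
stage. The quotient by this relation is a ring mapped to by every stage, and
testing the universal property of a given limit against it is what reveals the
elements of that limit. *)
Definition germ_rel : rel {i : I & X i} := fun a b =>
  `[< exists k (ak : (tag a <= k)%O) (bk : (tag b <= k)%O),
      f ak (tagged a) = f bk (tagged b) >].

Lemma germ_refl : reflexive germ_rel.
Proof. by move=> a; apply/asboolP; exists (tag a), (lexx _), (lexx _). Qed.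

Lemma germ_sym : symmetric germ_rel.
Proof.
by move=> a b; apply/asboolP/asboolP => -[k [h1 [h2 e]]]; exists k, h2, h1.
Qed.

Lemma germ_trans : transitive germ_rel.
Proof.
move=> b a c /asboolP[k [ak [bk e]]] /asboolP[l [bl [cl e']]].
have [_ /(_ k l)[m /andP[km lm]]] := dirI.
apply/asboolP; exists m, (le_trans ak km), (le_trans cl lm).
rewrite -(fcomp ak km) e -(fcomp cl lm) -e'.
by rewrite (fcomp bk km (le_trans bk km)) (fcomp bl lm (le_trans bk km)).
Qed.

Canonical germ_equiv := EquivRel germ_rel germ_refl germ_sym germ_trans.

Definition colim := {eq_quot germ_equiv}.
HB.instance Definition _ := Choice.on colim.
HB.instance Definition _ := EqQuotient.on colim.

Definition germ i (x : X i) : colim :=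
  \pi_colim (Tagged (fun i => (X i : Type)) x).

Lemma germ_eqP i j (x : X i) (y : X j) : germ x = germ y <->
  exists k (ik : (i <= k)%O) (jk : (j <= k)%O), f ik x = f jk y.
Proof. by split=> [/eqmodP/asboolP|h] //; apply/eqmodP/asboolP. Qed.

Lemma germ_push i j (ij : (i <= j)%O) (x : X i) : germ (f ij x) = germ x.
Proof. by apply/germ_eqP; exists j, (lexx j), ij; rewrite fid. Qed.

Lemma germ_repr (a : colim) : a = germ (tagged (repr a)).
Proof. by rewrite -{1}[a]reprK /germ; case: (repr a). Qed.

Lemma germ_ex (a : colim) : exists i (x : X i), a = germ x.
Proof. by exists (tag (repr a)), (tagged (repr a)); apply: germ_repr. Qed.

(** By directedness any two germs have representatives at one stage, so the
operations below are computed there and need no separate congruence proof for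
each argument. *)
Lemma germ_stage (a b : colim) :
  exists t : {i : I & (X i * X i)%type},
    a = germ (tagged t).1 /\ b = germ (tagged t).2.
Proof.
have [i [x ->]] := germ_ex a; have [j [y ->]] := germ_ex b.
have [_ /(_ i j)[k /andP[ik jk]]] := dirI.
exists (Tagged (fun i => (X i * X i)%type) (f ik x, f jk y)) => /=.
by rewrite !germ_push.
Qed.

Lemma germ_eq1 i (x y : X i) :
  germ x = germ y <-> exists k (ik : (i <= k)%O), f ik x = f ik y.
Proof.
split=> [/germ_eqP[k [ik [jk e]]]|[k [ik e]]].
  by exists k, ik; rewrite e (bool_irrelevance jk ik).
by apply/germ_eqP; exists k, ik, ik.
Qed.

Section Op.
Variable op : forall i, X i -> X i -> X i.
Hypothesis fop : forall i j (ij : (i <= j)%O) x y,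
  f ij (op x y) = op (f ij x) (f ij y).

Definition germ_op (a b : colim) : colim :=
  let t := tagged (projT1 (cid (germ_stage a b))) in germ (op t.1 t.2).

Lemma germ_opE i (x y : X i) : germ_op (germ x) (germ y) = germ (op x y).
Proof.
rewrite /germ_op; case: cid => -[j [x' y']] /= [].
move=> /germ_eqP[k [ik [jk e]]] /germ_eqP[l [il [jl e']]].
have [_ /(_ k l)[m /andP[km lm]]] := dirI.
have im := le_trans ik km; have jm := le_trans jk km.
apply/germ_eqP; exists m, jm, im; rewrite !fop; congr (op _ _).
  by rewrite -(fcomp ik km) e (fcomp jk km jm).
by rewrite -(fcomp il lm) e' (fcomp jl lm jm).
Qed.
End Op.

Let fD i j (ij : (i <= j)%O) (x y : X i) : f ij (x + y) = f ij x + f ij y.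
Proof. by rewrite raddfD. Qed.
Let fM i j (ij : (i <= j)%O) (x y : X i) :
  f ij (x * y)%g = (f ij x * f ij y)%g.
Proof. by rewrite gmulfM. Qed.

Lemma germ3 (a b c : colim) : exists i (x y z : X i),
  [/\ a = germ x, b = germ y & c = germ z].
Proof.
have [[i [x y]] /= [-> ->]] := germ_stage a b; have [j [z ->]] := germ_ex c.
have [_ /(_ i j)[k /andP[ik jk]]] := dirI.
by exists k, (f ik x), (f ik y), (f jk z); rewrite !germ_push.
Qed.

Definition colim_add := germ_op (fun i (x y : X i) => x + y).
Definition colim_mul := germ_op (fun i (x y : X i) => (x * y)%g).

Lemma colim_addE i (x y : X i) : colim_add (germ x) (germ y) = germ (x + y).
Proof. exact: germ_opE fD _ _ _. Qed.

Lemma colim_mulE i (x y : X i) :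
  colim_mul (germ x) (germ y) = germ (x * y)%g.
Proof. exact: germ_opE fM _ _ _. Qed.

Lemma colim_zero_ex : exists a : colim, forall i, a = germ (0 : X i).
Proof.
have [[i0] _] := dirI; exists (germ (0 : X i0)) => i.
have [_ /(_ i i0)[k /andP[ik jk]]] := dirI.
by apply/germ_eqP; exists k, jk, ik; rewrite !raddf0.
Qed.

Definition colim_zero := projT1 (cid colim_zero_ex).
Lemma colim_zeroE i : colim_zero = germ (0 : X i).
Proof. exact: (projT2 (cid colim_zero_ex)). Qed.

Definition colim_opp (a : colim) : colim :=
  germ (- tagged (repr a)).

Lemma colim_addA : associative colim_add.
Proof.
move=> a b c; have [i [x [y [z [-> -> ->]]]]] := germ3 a b c.
by rewrite !colim_addE addrA.
Qed.

Lemma colim_addC : commutative colim_add.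
Proof.
move=> a b; have [i [x [y [z [-> -> _]]]]] := germ3 a b b.
by rewrite !colim_addE addrC.
Qed.

Lemma colim_add0 : left_id colim_zero colim_add.
Proof.
move=> a; have [i [x ->]] := germ_ex a.
by rewrite (colim_zeroE i) colim_addE add0r.
Qed.

Lemma colim_addN : left_inverse colim_zero colim_opp colim_add.
Proof.
move=> a; rewrite {2}(germ_repr a) colim_addE addNr.
by rewrite (colim_zeroE (tag (repr a))).
Qed.

Lemma colim_mulA : associative colim_mul.
Proof.
move=> a b c; have [i [x [y [z [-> -> ->]]]]] := germ3 a b c.
by rewrite !colim_mulE mulgA.
Qed.

HB.instance Definition _ :=
  GRing.isZmodule.Build colim colim_addA colim_addC colim_add0 colim_addN.
HB.instance Definition _ := isSemigroup.Build colim colim_mulA.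

Lemma colim_mulDl (a b c : colim) :
  ((a + b)%R * c)%g = (a * c)%g + (b * c)%g.
Proof.
have [i [x [y [z [-> -> ->]]]]] := germ3 a b c.
transitivity (germ ((x + y)%R * z)%g).
  by rewrite -colim_mulE -colim_addE.
by rewrite rng_mulDl -colim_addE -!colim_mulE.
Qed.

Lemma colim_mulDr (a b c : colim) :
  (a * (b + c)%R)%g = (a * b)%g + (a * c)%g.
Proof.
have [i [x [y [z [-> -> ->]]]]] := germ3 a b c.
transitivity (germ (x * (y + z)%R)%g).
  by rewrite -colim_mulE -colim_addE.
by rewrite rng_mulDr -colim_addE -!colim_mulE.
Qed.

HB.instance Definition _ :=
  Zmodule_Semigroup_isRng.Build colim colim_mulDl colim_mulDr.

Lemma germ_morphism i : is_rng_morphism (@germ i).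
Proof.
split; last by move=> x y; rewrite -colim_mulE.
split; first by rewrite -colim_zeroE.
by move=> x y; rewrite -colim_addE.
Qed.

Lemma germ_cocone : @is_cocone rng_category disp I X f colim germ.
Proof.
by split=> [//|i|i j ij x]; [exact: germ_morphism|exact: germ_push].
Qed.

Variables (L : rngType) (p : forall i, rngMorphism (X i) L).
Hypothesis limL : @is_direct_limit rng_category disp I X f L p.

(** The limit maps to the ring of germs compatibly with all stages, so elements
of a stage identified in the limit have the same germ. *)
Lemma limit_eq i (x y : X i) : p i x = p i y ->
  exists k (ik : (i <= k)%O), f ik x = f ik y.
Proof.
move=> e; apply/germ_eq1.
have [h [_ hp _]] := limL.2 colim germ germ_cocone.
by rewrite -!hp e.
Qed.

(** The maps from the limit to the ring of germs and back compose to an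
endomorphism of the limit under every stage, which uniqueness forces to be the
identity. Hence an element of the limit is the image of a representative of its
germ. *)
Lemma limit_onto (a : L) : exists i (x : X i), p i x = a.
Proof.
have [h [[[h0 hD] hM] hp _]] := limL.2 colim germ germ_cocone.
pose k (b : colim) : L := p _ (tagged (repr b)).
have kE i (x : X i) : k (germ x) = p i x.
  rewrite /k; have /germ_eqP[l [il [jl e]]] := germ_repr (germ x).
  have C := cocone_comp limL.1.
  by rewrite -(C _ _ jl) -(C _ _ il) /= e.
have [i [x hx]] := germ_ex (h a); exists i, x; rewrite -kE -hx.
have [h1 [_ _ uniq1]] := limL.2 L p limL.1.
have -> : k (h a) = h1 a.
  apply: (uniq1 (k \o h)) => [|j y]; last by rewrite /= hp kE.
  split; first split.
  - have [[i0] _] := dirI.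
    by rewrite /= h0 [0](colim_zeroE i0) kE raddf0.
  - move=> y z /=; rewrite hD.
    have [j [u [v [_ [-> -> _]]]]] := germ3 (h y) (h z) (h z).
    by rewrite [_ + _]colim_addE !kE raddfD.
  - move=> y z /=; rewrite hM.
    have [j [u [v [_ [-> -> _]]]]] := germ3 (h y) (h z) (h z).
    by rewrite [(_ * _)%g]colim_mulE !kE gmulfM.
by symmetry; apply: (uniq1 id).
Qed.

End RingColimit.

(** * Matrices over a direct limit *)

(** The link of the sequences in the calligraphic S of a ring: [y * b] is a
left unit for [a]. It implies [precsim1 a b], with [a] as right factor. *)
Definition unital_below (R : rngType) (a b : Minf R) : Prop :=
  exists y : Minf R, a = (y * b * a)%g.

Section MatrixLimit.
Variables (disp : Order.disp_t) (I : preorderType disp) (X : I -> rngType).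
Variable f : forall i j : I, (i <= j)%O -> rngMorphism (X i) (X j).
Variables (L : rngType) (p : forall i, rngMorphism (X i) L).
Hypothesis dirI : directed I.
Hypothesis sysX : @is_direct_system rng_category disp I X f.
Hypothesis limL : @is_direct_limit rng_category disp I X f L p.

Lemma Minf_map_transition i j k (ij : (i <= j)%O) (jk : (j <= k)%O)
    (ik : (i <= k)%O) (x : Minf (X i)) :
  Minf_map (f jk) (Minf_map (f ij) x) = Minf_map (f ik) x.
Proof.
apply/fsfunP => q; rewrite !Minf_mapE.
exact: (dsys_comp sysX).
Qed.

Lemma Minf_map_transition_id i (ii : (i <= i)%O) (x : Minf (X i)) :
  Minf_map (f ii) x = x.
Proof. by apply/fsfunP => q; rewrite Minf_mapE; exact: (dsys_id sysX). Qed.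

Lemma Minf_map_limit i j (ij : (i <= j)%O) (x : Minf (X i)) :
  Minf_map (p j) (Minf_map (f ij) x) = Minf_map (p i) x.
Proof.
by apply/fsfunP => q; rewrite !Minf_mapE; exact: (cocone_comp limL.1).
Qed.

(** A matrix has finitely many nonzero entries, which lift to a common stage;
the same finiteness gives [Minf_limit_eq]. *)
Lemma Minf_limit_onto (x : Minf L) : exists i (y : Minf (X i)),
  Minf_map (p i) y = x.
Proof.
have H (r : seq (nat * nat)) : exists i (g : nat * nat -> X i),
    forall q, q \in r -> p i (g q) = x q.
  elim: r => [|q r [i [g hg]]].
    by have [[i0] _] := dirI; exists i0, (fun _ => 0).
  have [j [y hy]] := limit_onto dirI sysX limL (x q).
  have [_ /(_ i j)[k /andP[ik jk]]] := dirI.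
  have C := cocone_comp limL.1.
  exists k, (fun t => if t == q then f jk y else f ik (g t)) => t.
  rewrite inE; case: eqP => [->|_ /= tr]; first by rewrite [LHS](C _ _ jk).
  by rewrite [LHS](C _ _ ik) hg.
have [i [g hg]] := H (finsupp x).
exists i, [fsfun q in finsupp x => g q]; apply/fsfunP => q.
rewrite Minf_mapE fsfunE; case: ifPn => [/hg //|].
by rewrite mem_finsupp negbK raddf0 => /eqP ->.
Qed.

Lemma Minf_limit_eq i (x y : Minf (X i)) :
  Minf_map (p i) x = Minf_map (p i) y ->
  exists j (ij : (i <= j)%O), Minf_map (f ij) x = Minf_map (f ij) y.
Proof.
move=> exy.
have H (r : seq (nat * nat)) : exists j (ij : (i <= j)%O),
    forall q, q \in r -> f ij (x q) = f ij (y q).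
  elim: r => [|q r [j [ij hj]]]; first by exists i, (lexx i).
  have /(limit_eq dirI sysX limL)[k [ik hk]] : p i (x q) = p i (y q).
    by rewrite -!Minf_mapE exy.
  have [_ /(_ j k)[l /andP[jl kl]]] := dirI.
  have C := dsys_comp sysX; have il := le_trans ij jl.
  exists l, il => t; rewrite inE => /predU1P[->|tr].
    by rewrite -[LHS](C _ _ _ ik kl) -[RHS](C _ _ _ ik kl) /= hk.
  by rewrite -[LHS](C _ _ _ ij jl) -[RHS](C _ _ _ ij jl) /= hj.
have [j [ij hj]] := H (enum_fset (finsupp x) ++ enum_fset (finsupp y)).
exists j, ij; apply/fsfunP => q; rewrite !Minf_mapE.
have [|] := boolP (q \in enum_fset (finsupp x) ++ enum_fset (finsupp y)).
  exact: hj.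
by rewrite mem_cat negb_or !mem_finsupp !negbK => /andP[/eqP -> /eqP ->].
Qed.

Lemma Minf_limit_lift i (x : Minf L) :
  exists j (ij : (i <= j)%O) (y : Minf (X j)), Minf_map (p j) y = x.
Proof.
have [j [y <-]] := Minf_limit_onto x.
have [_ /(_ i j)[k /andP[ik jk]]] := dirI.
by exists k, ik, (Minf_map (f jk) y); rewrite Minf_map_limit.
Qed.

Lemma dense_rng_limit : (forall i, dense_rng (X i)) -> dense_rng L.
Proof.
move=> D x y [s [t ->]].
have [i [y' ey]] := Minf_limit_onto y.
have [j [ij [s' es]]] := Minf_limit_lift i s.
have [k [jk [t' et]]] := Minf_limit_lift j t.
pose y2 := Minf_map (f jk) (Minf_map (f ij) y').
pose s2 := Minf_map (f jk) s'.
have [|z [h1 h2]] := D k (s2 * y2 * t')%g y2; first by exists s2, t'.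
exists (Minf_map (p k) z); split.
  have := precsim1_map (p k) h1.
  by rewrite !Minf_mapM !Minf_map_limit ey es et.
by have := precsim1_map (p k) h2; rewrite !Minf_map_limit ey.
Qed.

Lemma left_normal_limit : (forall i, left_normal (X i)) -> left_normal L.
Proof.
move=> N a b c eab ebc.
have [i [a' ea]] := Minf_limit_onto a.
have [j [ij [b' eb]]] := Minf_limit_lift i b.
have [k [jk [c' ec]]] := Minf_limit_lift j c.
pose a2 := Minf_map (f jk) (Minf_map (f ij) a').
pose b2 := Minf_map (f jk) b'.
have [l [kl el]] : exists l (kl : (k <= l)%O),
    Minf_map (f kl) a2 = Minf_map (f kl) (b2 * a2)%g.
  by apply: Minf_limit_eq; rewrite Minf_mapM !Minf_map_limit ea eb.
have [m [lm em]] : exists m (lm : (l <= m)%O),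
    Minf_map (f lm) (Minf_map (f kl) b2) =
    Minf_map (f lm) (Minf_map (f kl) (c' * b2)%g).
  by apply: Minf_limit_eq; rewrite !Minf_map_limit Minf_mapM !Minf_map_limit
    eb ec.
pose up x := Minf_map (f lm) (Minf_map (f kl) x).
have upE x : Minf_map (p m) (up x) = Minf_map (p k) x.
  by rewrite !Minf_map_limit.
have [||d [e [h1 h2 h3]]] := N m (up a2) (up b2) (up c').
- by rewrite /up {1}el !Minf_mapM.
- by rewrite /up {1}em !Minf_mapM.
exists (Minf_map (p m) d), (Minf_map (p m) e); split.
- by have /(congr1 (Minf_map (p m))) := h1; rewrite Minf_mapM upE
    !Minf_map_limit ea.
- by have /(congr1 (Minf_map (p m))) := h2; rewrite Minf_mapM.
- by have /(congr1 (Minf_map (p m))) := h3; rewrite Minf_mapM upE ec.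
Qed.

(** The matrix [b] and the coefficients of the relation lift to a common stage,
where the defining equation need not hold; it holds further on, because it holds
in the limit. *)
Lemma precsim1_lift i (a : Minf (X i)) (b : Minf L) :
  precsim1 (Minf_map (p i) a) b ->
  exists j (ij : (i <= j)%O) (b' : Minf (X j)),
    Minf_map (p j) b' = b /\ precsim1 (Minf_map (f ij) a) b'.
Proof.
move=> [s [t e]].
have [j [ij [b' eb]]] := Minf_limit_lift i b.
have [k [jk [s' es]]] := Minf_limit_lift j s.
have [l [kl [t' et]]] := Minf_limit_lift k t.
have jl := le_trans jk kl; have il := le_trans ij jl.
have [m [lm em]] : exists m (lm : (l <= m)%O), Minf_map (f lm)
    (Minf_map (f il) a) = Minf_map (f lm)
    (Minf_map (f kl) s' * Minf_map (f jl) b' * t')%g.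
  by apply: Minf_limit_eq; rewrite !Minf_mapM !Minf_map_limit eb es et.
have im := le_trans il lm.
exists m, im, (Minf_map (f lm) (Minf_map (f jl) b')).
rewrite !Minf_map_limit; split=> //.
exists (Minf_map (f lm) (Minf_map (f kl) s')), (Minf_map (f lm) t').
by rewrite -(Minf_map_transition il lm) em !Minf_mapM.
Qed.

Lemma unital_below_lift i (a : Minf (X i)) (b : Minf L) :
  unital_below (Minf_map (p i) a) b ->
  exists j (ij : (i <= j)%O) (b' : Minf (X j)),
    Minf_map (p j) b' = b /\ unital_below (Minf_map (f ij) a) b'.
Proof.
move=> [s e].
have [j [ij [b' eb]]] := Minf_limit_lift i b.
have [k [jk [s' es]]] := Minf_limit_lift j s.
have ik := le_trans ij jk.
have [m [km em]] : exists m (km : (k <= m)%O), Minf_map (f km)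
    (Minf_map (f ik) a) = Minf_map (f km)
    (s' * Minf_map (f jk) b' * Minf_map (f ik) a)%g.
  by apply: Minf_limit_eq; rewrite !Minf_mapM !Minf_map_limit eb es.
have im := le_trans ik km.
exists m, im, (Minf_map (f km) (Minf_map (f jk) b')).
rewrite !Minf_map_limit; split=> //; exists (Minf_map (f km) s').
by rewrite -(Minf_map_transition ik km) {1}em !Minf_mapM.
Qed.

End MatrixLimit.

(** The invariant [Q] depends on the position in the sequence, so that the
sequence can follow a prescribed one. *)
Lemma dependent_choice_on (T : Type) (Q : nat -> T -> Prop)
    (E : T -> T -> Prop) (t0 : T) :
  Q 0%N t0 ->
  (forall n t, Q n t -> exists t', Q n.+1 t' /\ E t t') ->
  exists s : nat -> T, forall n, Q n (s n) /\ E (s n) (s n.+1).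
Proof.
move=> Q0 H.
have /choice[g hg] : forall nt : nat * T, exists t',
    Q nt.1 nt.2 -> Q nt.1.+1 t' /\ E nt.2 t'.
  move=> [n t].
  have [/H[t' ht']|nQ] := pselect (Q n t); first by exists t'.
  by exists t.
pose s := fix s n := if n is m.+1 then g (m, s m) else t0.
have Qs n : Q n (s n) by elim: n => // n IH; exact: (hg (n, s n) IH).1.
by exists s => n; split=> //; exact: (hg (n, s n) (Qs n)).2.
Qed.

(** * Suprema and bounded sequences *)

Section Sequences.
Variable R : rngType.
Implicit Types (a b c : Minf R) (x y z : Tseq R) (u v : nat -> Tseq R).

Definition tequiv x y : Prop := precsim x y /\ precsim y x.

Lemma tequiv_sym x y : tequiv x y -> tequiv y x.
Proof. by case. Qed.

Lemma tequiv_trans y x z : tequiv x y -> tequiv y z -> tequiv x z.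
Proof.
by move=> [a b] [c d]; split; [apply: precsim_trans a c|
  apply: precsim_trans d b].
Qed.

Lemma tseq_bound a x n : precsim1 a (x n) ->
  forall m, (n < m)%N -> precsim1 a (x m).
Proof. by move=> h m /(tseq_homo x); apply: precsim1_trans h. Qed.

(** The concrete form of the way-below relation, see [way_belowP]. *)
Definition below_term x y : Prop := exists m, forall k, precsim1 (x k) (y m).

Lemma below_termW x y : below_term x y -> precsim x y.
Proof. by move=> [m h] k; exists m. Qed.

Lemma below_term_trans x x' y y' :
  precsim x x' -> below_term x' y' -> precsim y' y -> below_term x y.
Proof.
move=> xx [m h] yy; have [l hl] := yy m; exists l => k.
have [j hj] := xx k.
exact: precsim1_trans hj (precsim1_trans (h j) hl).
Qed.

Lemma below_term_Toplus x x' y y' :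
  below_term x x' -> below_term y y' -> below_term (Toplus x y) (Toplus x' y').
Proof.
move=> [m h] [n h']; exists (maxn m n).+1 => k; apply: oplus_precsim1.
  by apply: (tseq_bound (h k)); rewrite ltnS leq_maxl.
by apply: (tseq_bound (h' k)); rewrite ltnS leq_maxr.
Qed.

Lemma Toplus_tequiv x x' y y' :
  tequiv x x' -> tequiv y y' -> tequiv (Toplus x y) (Toplus x' y').
Proof. by move=> [? ?] [? ?]; split; apply: Toplus_precsim. Qed.

(** [x] generates the union of the ideals generated by the [u k]. This is
stronger than being a supremum within a given class of sequences, and is the
form in which suprema are compatible with sums and with ring maps. *)
Definition tsup u x : Prop :=
  (forall k, precsim (u k) x) /\
  (forall n, exists k m, precsim1 (x n) (u k m)).

Lemma tsup_le u x y : tsup u x -> (forall k, precsim (u k) y) -> precsim x y.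
Proof.
move=> [_ h] uy n; have [k [m h']] := h n; have [l h''] := uy k m.
by exists l; apply: precsim1_trans h' h''.
Qed.

Lemma tsup_equiv u v x y : (forall k, tequiv (u k) (v k)) -> tequiv x y ->
  tsup u x -> tsup v y.
Proof.
move=> uv [xy yx] [h1 h2]; split=> [k|n].
  exact: precsim_trans (uv k).2 (precsim_trans (h1 k) xy).
have [m hm] := yx n; have [k [l h]] := h2 m; have [j hj] := (uv k).1 l.
by exists k, j; apply: precsim1_trans hm (precsim1_trans h hj).
Qed.

Lemma precsim_homo u : (forall k, precsim (u k) (u k.+1)) ->
  forall j k, (j <= k)%N -> precsim (u j) (u k).
Proof.
move=> inc j; elim=> [|k IH]; first by rewrite leqn0 => /eqP ->;
  apply: precsim_refl.
rewrite leq_eqVlt ltnS => /orP[/eqP ->|/IH h]; first exact: precsim_refl.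
exact: precsim_trans h (inc k).
Qed.

Lemma tsup_Toplus u v x y :
  (forall k, precsim (u k) (u k.+1)) -> (forall k, precsim (v k) (v k.+1)) ->
  tsup u x -> tsup v y -> tsup (fun k => Toplus (u k) (v k)) (Toplus x y).
Proof.
move=> iu iv [hu hu'] [hv hv']; split=> [k|n].
  by apply: Toplus_precsim.
have [k [m h]] := hu' n; have [k' [m' h']] := hv' n.
have [l hl] := precsim_homo iu (leq_maxl k k') m.
have [l' hl'] := precsim_homo iv (leq_maxr k k') m'.
exists (maxn k k'), (maxn l l').+1; apply: oplus_precsim1.
  apply: precsim1_trans h (tseq_bound hl _); by rewrite ltnS leq_maxl.
apply: precsim1_trans h' (tseq_bound hl' _); by rewrite ltnS leq_maxr.
Qed.

(** A cofinal diagonal in an increasing sequence of sequences. The offset [r]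
leaves room in the row [u k] after the selected term: its [r]-th successor is
still below the next selected term. *)
Lemma diagonal u (r : nat) : (forall k, precsim (u k) (u k.+1)) ->
  exists N : nat -> nat,
    (forall k, precsim1 (u k (N k + r)%N) (u k.+1 (N k.+1))) /\
    (forall j n, exists k, precsim1 (u j n) (u k (N k))).
Proof.
move=> inc.
have /choice[c hc] : forall t : nat * nat * nat, exists m,
    (t.1.1 <= t.1.2)%N -> precsim1 (u t.1.1 t.2) (u t.1.2 m).
  move=> [[j k] n] /=.
  have [jk|] := leqP j k; last by exists 0%N.
  by have [m hm] := precsim_homo inc jk n; exists m.
(* The next index bounds the terms of all earlier rows up to the position [B],
   which reaches the offset and also grows with [k], for cofinality. *)
pose B k N := maxn (N + r) k.
pose next k N :=
  (\max_(j < k.+1) \max_(n < (B k N).+1) c (j : nat, k.+1, n : nat)).+1.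
pose N := fix N k := if k is l.+1 then next l (N l) else 0%N.
have key k j n : (j <= k)%N -> (n <= B k (N k))%N ->
    precsim1 (u j n) (u k.+1 (N k.+1)).
  move=> jk nB; apply: (tseq_bound (hc (j, k.+1, n) (leq_trans jk (leqnSn k)))).
  rewrite /= /next ltnS.
  have hj : (j < k.+1)%N by [].
  have hn : (n < (B k (N k)).+1)%N by [].
  apply: leq_trans (leq_bigmax (Ordinal hj)).
  exact: (leq_bigmax (Ordinal hn)).
exists N; split=> [k|j n]; first by apply: key; rewrite ?leq_maxl.
exists (maxn j n).+1; apply: key; rewrite ?leq_maxl //.
by rewrite (leq_trans (leq_maxr j n)) // leq_maxr.
Qed.

Lemma tsup_diagonal u (N : nat -> nat) (s : Tseq R) :
  (forall j n, exists k, precsim1 (u j n) (u k (N k))) ->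
  (forall k, exists m, precsim1 (u k (N k)) (s m)) ->
  (forall k, exists j n, precsim1 (s k) (u j n)) ->
  tsup u s.
Proof.
move=> cof h1 h2; split=> [k n|//].
have [l hl] := cof k n; have [m hm] := h1 l.
by exists m; apply: precsim1_trans hl hm.
Qed.

Lemma tsup_exists u : (forall k, precsim (u k) (u k.+1)) ->
  exists s, tsup u s.
Proof.
move=> inc; have [N [h1 h2]] := diagonal 0 inc.
have h k : precsim1 (u k (N k)) (u k.+1 (N k.+1)).
  by have := h1 k; rewrite addn0.
exists (MkTseq h); apply: (tsup_diagonal h2) => k /=.
  by exists k.+1; apply: h.
by exists k.+1, (N k.+1); apply: h.
Qed.

(** * Closure and interpolation for chains *)

Definition chain (lk : Minf R -> Minf R -> Prop) x : Prop :=
  forall n, lk (x n) (x n.+1).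

Lemma unital_below_precsim1 a b : unital_below a b -> precsim1 a b.
Proof. by move=> [y e]; exists y, a. Qed.

(** The diagonal [A] of the rows is cofinal, but consecutive terms, taken from
different rows, need not be linked. With [B k] the term after [A k] in its row,
the links in that row give [A = y B A] and [B = s A' t B], where [A'] is the
next diagonal term and the right factor [t] is what obstructs the link from [A]
to [A']. Absorbing it into [z = t B A] leaves [A = y s A' z], so [z] is a left
multiple of [A' z], and since [A'] is itself a left multiple of [A'' z'], [z] is
a left multiple of [z' z]. *)
Lemma tsup_unital u : (forall k, chain (@unital_below R) (u k)) ->
  (forall k, precsim (u k) (u k.+1)) ->
  exists2 s, chain (@unital_below R) s & tsup u s.
Proof.
move=> ch inc; have [N [h1 h2]] := diagonal 2 inc.
pose A k := u k (N k); pose B k := u k (N k).+1.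
have /choice[w hw] : forall k, exists w : Minf R * Minf R * Minf R,
    A k = (w.1.1 * B k * A k)%g /\ B k = (w.1.2 * A k.+1 * w.2 * B k)%g.
  move=> k.
  have [y ey] := ch k (N k); have [y' ey'] := ch k (N k).+1.
  have := h1 k; rewrite addn2 => -[s [t est]].
  exists (y, (y' * s)%g, t) => /=; split; first exact: ey.
  by rewrite /B {1}ey' est !mulgA.
pose y k := (w k).1.1; pose s k := (w k).1.2; pose t k := (w k).2.
have eA k : A k = (y k * B k * A k)%g := (hw k).1.
have eB k : B k = (s k * A k.+1 * t k * B k)%g := (hw k).2.
pose z k := (t k * B k * A k)%g.
have eAz k : A k = (y k * s k * A k.+1 * z k)%g.
  by rewrite {1}eA {1}eB /z !mulgA.
have ub k : unital_below (z k) (z k.+1).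
  (* [z = t B A] with both [A] and then [A'] expanded by [eAz]. *)
  exists (t k * B k * y k * s k * y k.+1 * s k.+1 * A k.+2)%g.
  rewrite {1}/z {1}eAz {1}eAz !mulgA; congr (_ * _)%g.
exists (MkTseq (fun k => unital_below_precsim1 (ub k))) => //.
apply: (tsup_diagonal h2) => k /=.
  (* [A'] is a left multiple of [z'], which without a unit does not place it
     below [z']; the missing right factor comes from [A] being below [A']. *)
  exists k.+1; have := h1 k; rewrite addn2 => -[a [b e]].
  have : precsim1 (A k) (A k.+1).
    apply: (@precsim1_trans _ (u k (N k).+2)); first exact: tseq_homo.
    by exists a, b.
  case=> a' [b' e']; exists (a' * y k.+1 * s k.+1 * A k.+2)%g, b'.
  by rewrite -/(A k) e' {1}eAz !mulgA.
exists k.+1, (N k.+1); rewrite -/(A k.+1).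
by exists (t k * B k * y k * s k)%g, (z k); rewrite {1}/z {1}eAz !mulgA.
Qed.

Lemma dense_interpolation a b : dense_rng R -> precsim1 a b ->
  exists z, precsim1 a (z 0%N) /\ forall k, precsim1 (z k) b.
Proof.
move=> D /D[z0 [h1 h2]].
have [|s hs] := @dependent_choice_on _ (fun n c => precsim1 c b /\
  (n = 0%N -> precsim1 a c)) (fun c c' => precsim1 c c') z0
  (conj h2 (fun=> h1)).
  by move=> n c [/D[c' [? ?]] _]; exists c'.
exists (MkTseq (fun n => (hs n).2)) => /=; split=> [|k].
  exact: (hs 0%N).1.2.
exact: (hs k).1.1.
Qed.

(** From [a = y b a] and [b = y' c b] one gets that [b y] is a left unit for
[b a], and [y' c] one for [b y]. Left normality inserts [d] and [e] between
these; applied again to [d], [e], [y' c] it inserts two more, and so on. The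
successive [d] form a chain, all of them fixed by [y' c] on the left and hence
below [c]; the first one is a left unit for [b a], of which [a] is a left
multiple. *)
Lemma left_normal_interpolation a b c : left_normal R ->
  unital_below a b -> unital_below b c ->
  exists2 z, chain (@unital_below R) z &
    precsim1 a (z 0%N) /\ forall k, precsim1 (z k) c.
Proof.
move=> N [y eab] [y' ebc].
have [d [e [h1 h2 h3]]] : exists d e : Minf R,
    [/\ b * a = d * (b * a), d = e * d & e = (y' * c) * e]%g.
  apply: (N _ (b * y)%g); rewrite ?mulgA; first by rewrite {1}eab !mulgA.
  by rewrite -ebc.
have [|s hs] := @dependent_choice_on _ (fun n (de : Minf R * Minf R) =>
    [/\ n = 0%N -> b * a = de.1 * (b * a), de.1 = de.2 * de.1 &
    de.2 = (y' * c) * de.2]%g)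
  (fun de de' => de.1 = de'.1 * de.1)%g (d, e) (And3 (fun=> h1) h2 h3).
  move=> n [d1 e1] /= [_ k2 k3]; have [d2 [e2 [l1 l2 l3]]] := N _ _ _ k2 k3.
  by exists (d2, e2).
pose z n := (s n).1.
have ez n : z n = (z n.+1 * z n)%g := (hs n).2.
have ub n : unital_below (z n) (z n.+1).
  (* [z n.+1] acts on [z n] as [z n.+2 * z n.+1] does. *)
  by exists (z n.+2); rewrite -!ez.
exists (MkTseq (fun n => unital_below_precsim1 (ub n))) => //=; split=> [|k].
  have [/(_ erefl) k1 _ _] := (hs 0%N).1.
  by exists y, (b * a)%g; rewrite -mulgA -k1 mulgA.
have [_ k2 k3] := (hs k).1.
by exists y', ((s k).2 * z k)%g; rewrite mulgA -k3.
Qed.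

Definition interpolating (lk : Minf R -> Minf R -> Prop) : Prop :=
  forall a b c, lk a b -> lk b c ->
  exists2 z, chain lk z & precsim1 a (z 0%N) /\ forall k, precsim1 (z k) c.

Definition sup_closed (lk : Minf R -> Minf R -> Prop) : Prop :=
  forall u, (forall k, chain lk (u k)) ->
  (forall k, precsim (u k) (u k.+1)) -> exists2 s, chain lk s & tsup u s.

End Sequences.

(** * Semigroups of classes of chains *)

Section PomFacts.
Variable S : pomType.
Implicit Types (x y : S) (u v : nat -> S).

Lemma is_sup_uniq u x y : is_sup u x -> is_sup u y -> x = y.
Proof. by move=> [h1 h2] [h3 h4]; apply: pom_le_anti; auto. Qed.

Lemma way_below_le x y : way_below x y -> pom_le x y.
Proof.
move=> h; have [|||//] := h (fun=> y) y.
- by move=> n; apply: pom_le_refl.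
- by split=> [n|t /(_ 0%N)//]; apply: pom_le_refl.
- exact: pom_le_refl.
Qed.

Lemma way_below_trans x x' y y' :
  pom_le x x' -> way_below x' y' -> pom_le y' y -> way_below x y.
Proof.
move=> xx h yy u s iu us ys.
have [m hm] := h u s iu us (pom_le_trans _ _ _ yy ys).
by exists m; apply: pom_le_trans xx hm.
Qed.

Lemma way_below_increasing u :
  (forall n, way_below (u n) (u n.+1)) -> increasing u.
Proof. by move=> h n; apply: way_below_le. Qed.

Lemma way_below_sup u x n : (forall k, way_below (u k) (u k.+1)) ->
  is_sup u x -> way_below (u n) x.
Proof.
move=> h [ub _]; exact: way_below_trans (pom_le_refl _) (h n) (ub _).
Qed.

End PomFacts.

(** [S] is the ordered monoid of classes of [lk]-chains. The representative of
an element is only required to be equivalent to a chain, which is all that can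
be said of the chosen representatives of the elements of S(R). *)
Record represents (R : rngType) (lk : Minf R -> Minf R -> Prop) (S : pomType)
    (rep : S -> Tseq R) : Prop := Represents {
  rep_le : forall a b, pom_le a b <-> precsim (rep a) (rep b);
  rep_zero : precsim (rep 0) (Tzero R);
  rep_add : forall a b, tequiv (rep (a + b)) (Toplus (rep a) (rep b));
  rep_chain : forall a, exists2 z, chain lk z & tequiv (rep a) z;
  rep_onto : forall z, chain lk z -> exists a, tequiv (rep a) z
}.

Section Represented.
Variables (R : rngType) (lk : Minf R -> Minf R -> Prop) (S : pomType).
Variable rep : S -> Tseq R.
Hypothesis repS : represents lk rep.
Hypothesis interp : interpolating lk.
Hypothesis supc : sup_closed lk.
Implicit Types (x y : S) (u v : nat -> S).

Lemma tsup_is_sup u x : tsup (rep \o u) (rep x) -> is_sup u x.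
Proof.
move=> h; split=> [n|t ut]; apply/(rep_le repS); first exact: h.1.
by apply: tsup_le h _ => k; apply/(rep_le repS).
Qed.

Lemma rep_sup_exists u : increasing u -> exists x, tsup (rep \o u) (rep x).
Proof.
move=> inc.
have /choice[v hv] k : exists z, chain lk z /\ tequiv (rep (u k)) z.
  by have [z ? ?] := rep_chain repS (u k); exists z.
have [k|k|s cs us] := supc (u := v); first exact: (hv k).1.
  apply: precsim_trans (hv k).2.2 _; apply: precsim_trans (hv k.+1).2.1.
  by apply/(rep_le repS).
have [x hx] := rep_onto repS cs; exists x.
by apply: tsup_equiv us => [k|]; apply: tequiv_sym => //; exact: (hv k).2.
Qed.

(** Suprema in [S] are unions of ideals because a union is again generated by a
chain, and suprema are unique. *)
Lemma is_sup_tsup u x : increasing u -> is_sup u x -> tsup (rep \o u) (rep x).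
Proof.
move=> inc ux; have [y hy] := rep_sup_exists inc.
by rewrite (is_sup_uniq ux (tsup_is_sup hy)).
Qed.

Lemma below_term_way_below x y :
  below_term (rep x) (rep y) -> way_below x y.
Proof.
move=> [m hm] u s inc us ys.
have [_ h] := is_sup_tsup inc us.
have /(_ m)[n hn] : precsim (rep y) (rep s) by apply/(rep_le repS).
have [k [l hl]] := h n; exists k; apply/(rep_le repS) => j; exists l.
exact: precsim1_trans (hm j) (precsim1_trans hn hl).
Qed.

Lemma rep_between x n : exists y m,
  precsim1 (rep x n) (rep y m) /\
  exists2 l, (n < l)%N & forall k, precsim1 (rep y k) (rep x l).
Proof.
have [z cz [xz zx]] := rep_chain repS x.
have [j hj] := xz n.
have [w cw [h1 h2]] := interp (cz j) (cz j.+1).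
have [y [yw wy]] := rep_onto repS cw.
have [m hm] := wy 0%N; have [l hl] := zx j.+2.
exists y, m; split; first exact: precsim1_trans hj (precsim1_trans h1 hm).
exists (maxn n l).+1 => [|k]; first by rewrite ltnS leq_maxl.
have [i hi] := yw k.
apply: (tseq_bound (n := l)); last by rewrite ltnS leq_maxr.
exact: precsim1_trans hi (precsim1_trans (h2 i) hl).
Qed.

(** Chains interpolated along a subsequence [q] of the terms of [x]: each is
bounded by a term of [x] which lies below some term of the next chain. *)
Lemma rep_approximation x : exists2 u,
  (forall n, below_term (rep (u n)) (rep (u n.+1))) & tsup (rep \o u) (rep x).
Proof.
have /choice[g hg] : forall n, exists yl : S * nat,
    (exists m, precsim1 (rep x n) (rep yl.1 m)) /\ (n < yl.2)%N /\
    (forall k, precsim1 (rep yl.1 k) (rep x yl.2)).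
  move=> n; have [y [m [h [l nl hl]]]] := rep_between x n.
  by exists (y, l); split; first exists m.
pose q := fix q n := if n is m.+1 then (g (q m)).2 else 0%N.
have nq n : (n <= q n)%N.
  elim: n => // n IH; exact: leq_ltn_trans IH (hg (q n)).2.1.
exists (fun n => (g (q n)).1) => [n|]; last split=> [k n|n].
- have [m hm] := (hg (q n.+1)).1.
  by exists m => k; apply: precsim1_trans ((hg (q n)).2.2 k) hm.
- by exists (q k.+1); apply: (hg (q k)).2.2.
- exists n.+1; have [m hm] := (hg (q n.+1)).1; exists m.
  by apply: precsim1_trans hm; apply: tseq_homo; apply: nq.
Qed.

Lemma way_belowP x y : way_below x y <-> below_term (rep x) (rep y).
Proof.
split=> [xy|]; last exact: below_term_way_below.
have [u hu /[dup] su /tsup_is_sup us] := rep_approximation y.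
have [|m hm] := xy u y _ us (pom_le_refl y).
  by move=> n; apply/(rep_le repS)/below_termW.
apply: below_term_trans (hu m) (su.1 m.+1); exact/(rep_le repS).
Qed.

Lemma represents_is_Cu : is_Cu S.
Proof.
have repinc u : increasing u -> forall k, precsim (rep (u k)) (rep (u k.+1)).
  by move=> inc k; apply/(rep_le repS).
split=> [u inc|x|x' x y' y|u v s t iu iv us vt].
- by have [x /tsup_is_sup hx] := rep_sup_exists inc; exists x.
- have [u hu /tsup_is_sup ux] := rep_approximation x; exists u => // n.
  exact/way_belowP.
- move=> /way_belowP hx /way_belowP hy; apply/way_belowP.
  apply: below_term_trans (below_term_Toplus hx hy) _.
    exact: (rep_add repS _ _).1.
  exact: (rep_add repS _ _).2.
- apply: tsup_is_sup.
  apply: tsup_equiv (tsup_Toplus (repinc _ iu) (repinc _ iv)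
    (is_sup_tsup iu us) (is_sup_tsup iv vt)) => [k|] /=;
  exact: tequiv_sym (rep_add repS _ _).
Qed.

End Represented.

(** * Maps induced by ring morphisms *)

Section TmapFacts.
Variables (R R' : rngType) (phi : rngMorphism R R').
Implicit Types (x y : Tseq R).

Lemma Tmap_precsim x y : precsim x y -> precsim (Tmap phi x) (Tmap phi y).
Proof.
by move=> h n; have [m hm] := h n; exists m; apply: precsim1_map.
Qed.

Lemma Tmap_tequiv x y : tequiv x y -> tequiv (Tmap phi x) (Tmap phi y).
Proof. by move=> [? ?]; split; apply: Tmap_precsim. Qed.

Lemma Tmap_below_term x y :
  below_term x y -> below_term (Tmap phi x) (Tmap phi y).
Proof. by move=> [m h]; exists m => k; apply: precsim1_map. Qed.

Lemma Tmap_tsup u x : tsup u x -> tsup (Tmap phi \o u) (Tmap phi x).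
Proof.
move=> [h1 h2]; split=> [k|n]; first exact: Tmap_precsim.
by have [k [m h]] := h2 n; exists k, m; apply: precsim1_map.
Qed.

(** A ring morphism may shrink the corner of a matrix, so it does not commute
with [oplus]; it does commute with [interleave], whose entries do not depend on
sizes. *)
Lemma Tmap_Toplus x y :
  tequiv (Tmap phi (Toplus x y)) (Toplus (Tmap phi x) (Tmap phi y)).
Proof.
have I (R0 : rngType) (x0 y0 : Tseq R0) :
    tequiv (Toplus x0 y0) (Tinterleave x0 y0).
  exact/Lambda_eqP/Toplus_interleave.
apply: tequiv_trans (Tmap_tequiv (I _ x y)) _.
apply: tequiv_trans (tequiv_sym (I _ _ _)).
have E n : Tmap phi (Tinterleave x y) n =
    Tinterleave (Tmap phi x) (Tmap phi y) n.
  apply/mxP => i j; rewrite /= Minf_mapE !interleaveE /block2.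
  by case: (dparity i) => ?; case: (dparity j) => ?;
    rewrite ?Minf_mapE ?raddf0.
by split=> n; exists n.+1; rewrite ?E -?E; apply: tseqP.
Qed.

End TmapFacts.

Section RepresentedMorphism.
Variables (R R' : rngType) (phi : rngMorphism R R').
Variables (lk : Minf R -> Minf R -> Prop) (lk' : Minf R' -> Minf R' -> Prop).
Variables (S S' : pomType) (rep : S -> Tseq R) (rep' : S' -> Tseq R').
Hypotheses (repS : represents lk rep) (repS' : represents lk' rep').
Hypotheses (interp : interpolating lk) (interp' : interpolating lk').
Hypotheses (supc : sup_closed lk) (supc' : sup_closed lk').
Variable F : S -> S'.
Hypothesis repF : forall a, tequiv (rep' (F a)) (Tmap phi (rep a)).

Lemma represented_is_Cu_morphism : is_Cu_morphism F.
Proof.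
split=> [|x y /(rep_le repS) xy|x y|u s inc us].
- split=> [|a b].
    apply: pom_le_anti; last exact: pom_le0x.
    apply/(rep_le repS'); apply: precsim_trans (repF 0).1 _.
    apply: precsim_trans (Tmap_precsim phi (rep_zero repS)) _ => n.
    exists 0%N; rewrite /= (_ : Minf_map _ _ = Minf0 R').
      exact: precsim10.
    by apply/mxP => ? ?; rewrite Minf_mapE !Minf0E raddf0.
  have : tequiv (rep' (F (a + b)%R)) (rep' (F a + F b)%R).
    apply: tequiv_trans (repF _) _.
    apply: tequiv_trans (Tmap_tequiv phi (rep_add repS a b)) _.
    apply: tequiv_trans (Tmap_Toplus phi _ _) _.
    apply: tequiv_trans (tequiv_sym (rep_add repS' _ _)).
    by apply: Toplus_tequiv; apply: tequiv_sym.
  by case=> h1 h2; apply: pom_le_anti; apply/(rep_le repS').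
- apply/(rep_le repS'); apply: precsim_trans (repF x).1 _.
  apply: precsim_trans (repF y).2; exact: Tmap_precsim.
- move=> /(way_belowP repS interp supc) xy.
  apply/(way_belowP repS' interp' supc').
  exact: below_term_trans (repF x).1 (Tmap_below_term phi xy) (repF y).2.
- apply: (tsup_is_sup repS').
  apply: tsup_equiv (Tmap_tsup phi (is_sup_tsup repS supc inc us)) => [k|] /=;
  exact: tequiv_sym.
Qed.

End RepresentedMorphism.

(** * Direct limits in Cu *)

Section CuLimit.
Variables (disp : Order.disp_t) (I : preorderType disp) (S : I -> pomType).
Variable f : forall i j : I, (i <= j)%O -> S i -> S j.
Variables (T : pomType) (p : forall i, S i -> T).
Hypothesis dirI : directed I.
Hypothesis sysS : @is_direct_system Cu_category disp I S f.
Hypothesis cocT : @is_cocone Cu_category disp I S f T p.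

(** [x] is a supremum of elements from later and later stages, increasing for
the way-below relation after transition to the next stage. *)
Record approximates (i : nat -> I) (z : forall n, S (i n)) (x : T) : Prop :=
  Approximates {
  approx_step : forall n, exists h : (i n <= i n.+1)%O,
    way_below (f h (z n)) (z n.+1);
  approx_sup : is_sup (fun n => p (z n)) x
}.

Hypothesis approx_exists : forall x, exists i z, @approximates i z x.
Hypothesis limit_le : forall i (z' z w : S i),
  way_below z' z -> pom_le (p z) (p w) ->
  exists j (ij : (i <= j)%O), pom_le (f ij z') (f ij w).

Let fmorph i j (ij : (i <= j)%O) : is_Cu_morphism (f ij).
Proof. exact: (dsys_morphism sysS). Qed.

Let fcomp i j k (ij : (i <= j)%O) (jk : (j <= k)%O) (ik : (i <= k)%O) x :
  f jk (f ij x) = f ik x.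
Proof. exact: (dsys_comp sysS). Qed.

Lemma approx_increasing (Y : pomType) (g : forall i, S i -> Y) i z x :
  @is_cocone Cu_category disp I S f Y g -> @approximates i z x ->
  forall n, way_below (g _ (z n)) (g _ (z n.+1)).
Proof.
move=> cocY [st _] n; have [h zz] := st n; rewrite -(cocone_comp cocY h).
exact (Cu_morph_way_below (cocone_morphism cocY _) zz).
Qed.

Lemma approx_term_below i z x n :
  @approximates i z x -> way_below (p (z n)) x.
Proof.
move=> az; exact: way_below_sup (approx_increasing cocT az) (approx_sup az).
Qed.

Lemma approx_p_increasing i z x : @approximates i z x ->
  increasing (fun n => p (z n)).
Proof. by move=> /(approx_increasing cocT)/way_below_increasing. Qed.

Section Cocone.
Variables (Y : pomType) (g : forall i, S i -> Y).
Hypothesis cocY : @is_cocone Cu_category disp I S f Y g.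

Let gmorph i : is_Cu_morphism (@g i) := cocone_morphism cocY i.
Let gcomp i j (ij : (i <= j)%O) x : g (f ij x) = g x := cocone_comp cocY ij x.

(** The value that a map of cocones must take at [x] is the supremum of the
images of any approximation of [x]; this comparison makes it well defined and
monotone. *)
Lemma approx_le i z x i' z' x' y y' :
  @approximates i z x -> @approximates i' z' x' -> pom_le x x' ->
  is_sup (fun n => g (z n)) y -> is_sup (fun n => g (z' n)) y' -> pom_le y y'.
Proof.
move=> az az' xx' [_ suby] [uby' _]; apply: suby => n.
(* The term [z n.+1] is way below [x] and so under some [z' m] in [T]; only
   [z n], way below it, is then under [z' m] at a stage. *)
have [m hm] := approx_term_below n.+1 az (approx_p_increasing az')
  (approx_sup az') xx'.
have [h zz] := approx_step az n.
have [_ /(_ (i n.+1) (i' m))[k /andP[ik jk]]] := dirI.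
have nk := le_trans h ik.
have [||l [kl]] := @limit_le k (f nk (z n)) (f ik (z n.+1)) (f jk (z' m)).
- by rewrite -(fcomp h ik); exact (Cu_morph_way_below (fmorph _) zz).
- by rewrite !(cocone_comp cocT).
move=> /(Cu_morph_le (gmorph l)); rewrite !gcomp => hle.
exact: pom_le_trans _ hle (uby' m).
Qed.

Lemma approx_image_exists x : exists y, exists i z,
  @approximates i z x /\ is_sup (fun n => g (z n)) y.
Proof.
have [i [z az]] := approx_exists x.
have [y hy] := Cu_O1 (cocone_object cocY)
  (way_below_increasing (approx_increasing cocY az)).
by exists y, i, z.
Qed.

Definition limit_map (x : T) : Y := projT1 (cid (approx_image_exists x)).

Lemma limit_mapP x i z : @approximates i z x ->
  is_sup (fun n => g (z n)) (limit_map x).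
Proof.
rewrite /limit_map; case: cid => y /= [i' [z' [a' hy]]] az.
have [y' hy'] := Cu_O1 (cocone_object cocY)
  (way_below_increasing (approx_increasing cocY az)).
suff -> : y = y' by [].
by apply: pom_le_anti;
  [apply: approx_le a' az _ hy hy'|apply: approx_le az a' _ hy' hy];
  apply: pom_le_refl.
Qed.

Lemma limit_map_le x x' : pom_le x x' -> pom_le (limit_map x) (limit_map x').
Proof.
move=> xx; have [i [z az]] := approx_exists x.
have [i' [z' az']] := approx_exists x'.
exact: approx_le az az' xx (limit_mapP az) (limit_mapP az').
Qed.

Lemma approx_const i (s : S i) : exists z,
  @approximates (fun=> i) z (p s) /\ is_sup z s.
Proof.
have [z zz zs] := Cu_O2 (dsys_object sysS i) s.
exists z; split=> //; split=> [n|].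
  by exists (lexx i); rewrite [f _ _](dsys_id sysS).
exact (Cu_morph_sup (cocone_morphism cocT i) (way_below_increasing zz) zs).
Qed.

Lemma limit_map_p i (s : S i) : limit_map (p s) = g s.
Proof.
have [z [az zs]] := approx_const s.
apply: is_sup_uniq (limit_mapP az) _.
refine (Cu_morph_sup (gmorph i) _ zs).
apply: way_below_increasing => n.
by have [h] := approx_step az n; rewrite [f _ _](dsys_id sysS).
Qed.

Lemma limit_map_sup u s : increasing u -> is_sup u s ->
  is_sup (fun n => limit_map (u n)) (limit_map s).
Proof.
move=> inc us; split=> [n|t ut]; first by apply: limit_map_le; exact: us.1.
have [i [z az]] := approx_exists s.
apply: (limit_mapP az).2 => n.
have [m /limit_map_le hm] := approx_term_below n az inc us (pom_le_refl s).
by rewrite -limit_map_p; apply: pom_le_trans _ hm (ut m).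
Qed.

Lemma limit_map_way_below x y : way_below x y ->
  way_below (limit_map x) (limit_map y).
Proof.
move=> xy; have [i [z az]] := approx_exists y.
have [m hm] := xy _ _ (approx_p_increasing az) (approx_sup az) (pom_le_refl y).
apply: way_below_trans (limit_map_le hm) _ ((limit_mapP az).1 m.+1).
rewrite limit_map_p; exact: approx_increasing cocY az m.
Qed.

Lemma limit_map0 : limit_map 0 = 0.
Proof.
have [[i] _] := dirI.
by rewrite -(Cu_morphD (cocone_morphism cocT i)).1 limit_map_p
  (Cu_morphD (gmorph i)).1.
Qed.

(** The approximations of [x] and [y] run through different stages; their sum is
formed at common upper bounds [k n] of these, chosen to be increasing. *)
Lemma limit_mapD x y : limit_map (x + y) = limit_map x + limit_map y.
Proof.
have [i [z az]] := approx_exists x; have [j [w aw]] := approx_exists y.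
have [_ dir] := dirI.
have [k0 /andP[ik0 jk0]] := dir (i 0%N) (j 0%N).
have [|k hk] := @dependent_choice_on _
    (fun n k => (i n <= k)%O /\ (j n <= k)%O) (fun k k' => (k <= k')%O)
    k0 (conj ik0 jk0).
  move=> n k [_ _]; have [l /andP[il jl]] := dir (i n.+1) (j n.+1).
  have [m /andP[km lm]] := dir k l.
  by exists m; split; [split; apply: le_trans lm|].
pose v n := f (hk n).1.1 (z n) + f (hk n).1.2 (w n).
have pv n : p (v n) = p (z n) + p (w n).
  by rewrite (Cu_morphD (cocone_morphism cocT _)).2 !(cocone_comp cocT).
have gv n : g (v n) = g (z n) + g (w n).
  by rewrite (Cu_morphD (gmorph _)).2 !gcomp.
have av : approximates v (x + y).
  split=> [n|].
    exists (hk n).2; rewrite (Cu_morphD (fmorph _)).2.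
    have [h zz] := approx_step az n; have [h' ww] := approx_step aw n.
    apply: Cu_O3 (dsys_object sysS _) _ _ _ _ _ _.
      rewrite (fcomp _ _ (le_trans h (hk n.+1).1.1)) -(fcomp h (hk n.+1).1.1).
      exact (Cu_morph_way_below (fmorph _) zz).
    rewrite (fcomp _ _ (le_trans h' (hk n.+1).1.2)) -(fcomp h' (hk n.+1).1.2).
    exact (Cu_morph_way_below (fmorph _) ww).
  have -> : (fun n => p (v n)) = (fun n => p (z n) + p (w n)) by apply/funext.
  exact (Cu_O4 (cocone_object cocT) (approx_p_increasing az)
    (approx_p_increasing aw) (approx_sup az) (approx_sup aw)).
apply: is_sup_uniq (limit_mapP av) _.
have -> : (fun n => g (v n)) = (fun n => g (z n) + g (w n)) by apply/funext.
exact (Cu_O4 (cocone_object cocY)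
  (way_below_increasing (approx_increasing cocY az))
  (way_below_increasing (approx_increasing cocY aw))
  (limit_mapP az) (limit_mapP aw)).
Qed.

Lemma limit_map_morphism : is_Cu_morphism limit_map.
Proof.
split; [|exact: limit_map_le|exact: limit_map_way_below|exact: limit_map_sup].
by split; [exact: limit_map0|exact: limit_mapD].
Qed.

Lemma limit_map_uniq (h : T -> Y) : is_Cu_morphism h ->
  (forall i (s : S i), h (p s) = g s) -> h =1 limit_map.
Proof.
move=> hm hp x; have [i [z az]] := approx_exists x.
apply: is_sup_uniq (limit_mapP az).
have := Cu_morph_sup hm (approx_p_increasing az) (approx_sup az).
by under eq_fun do rewrite hp.
Qed.

End Cocone.

(** Approximations determine every map out of [T], and [limit_le] makes the
values that they prescribe independent of the approximation, so a cocone over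
the system in Cu that satisfies both hypotheses is universal. *)
Lemma Cu_direct_limit : @is_direct_limit Cu_category disp I S f T p.
Proof.
split=> // Y g cocY; exists (limit_map cocY); split.
- exact: limit_map_morphism.
- exact: limit_map_p.
- exact: limit_map_uniq.
Qed.

End CuLimit.

(** * Continuity *)

Definition link := forall R : rngType, Minf R -> Minf R -> Prop.

(** What the two cases have to supply about the class [P] of rings and the
relation whose chains represent the elements of the semigroup. *)
Record continuous_link (P : rngType -> Prop) (lk : link) : Prop :=
  ContinuousLink {
  link_interp : forall R, P R -> interpolating (@lk R);
  link_sup : forall R, sup_closed (@lk R);
  link_map : forall (R R' : rngType) (phi : rngMorphism R R') a b,
    lk R a b -> lk R' (Minf_map phi a) (Minf_map phi b);
  link_limit : forall (disp : Order.disp_t) (I : preorderType disp)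
    (X : I -> rngType)
    (f : forall i j : I, (i <= j)%O -> rngMorphism (X i) (X j))
    (L : rngType) (p : forall i, rngMorphism (X i) L),
    directed I ->
    @is_direct_system rng_category disp I X f ->
    @is_direct_limit rng_category disp I X f L p ->
    (forall i, P (X i)) -> P L;
  link_lift : forall (disp : Order.disp_t) (I : preorderType disp)
    (X : I -> rngType)
    (f : forall i j : I, (i <= j)%O -> rngMorphism (X i) (X j))
    (L : rngType) (p : forall i, rngMorphism (X i) L),
    directed I ->
    @is_direct_system rng_category disp I X f ->
    @is_direct_limit rng_category disp I X f L p ->
    forall i (a : Minf (X i)) (b : Minf L), lk L (Minf_map (p i) a) b ->
    exists j (ij : (i <= j)%O) (b' : Minf (X j)),
      Minf_map (p j) b' = b /\ lk _ (Minf_map (f i j ij) a) b'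
}.

Section Continuity.
Variables (P : rngType -> Prop) (lk : link).
Variables (F : rngType -> pomType).
Variable Fmap : forall R R' : rngType, rngMorphism R R' -> F R -> F R'.
Variable rep : forall R, F R -> Tseq R.
Hypothesis lkP : continuous_link P lk.
Hypothesis repF : forall R, represents (@lk R) (@rep R).
Hypothesis repFmap : forall (R R' : rngType) (phi : rngMorphism R R') a,
  tequiv (rep (Fmap phi a)) (Tmap phi (rep a)).

Lemma represented_is_Cu R : P R -> is_Cu (F R).
Proof.
by move=> PR; exact: represents_is_Cu (repF R) (link_interp lkP PR)
  (link_sup lkP (R := R)).
Qed.

Lemma Fmap_is_Cu_morphism R R' (phi : rngMorphism R R') : P R -> P R' ->
  is_Cu_morphism (Fmap phi).
Proof.
move=> PR PR'; exact: (represented_is_Cu_morphism (repF R) (repF R')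
  (link_interp lkP PR) (link_interp lkP PR') (link_sup lkP (R := R))
  (link_sup lkP (R := R')) (repFmap phi)).
Qed.

Lemma tequiv_ext R (x y : Tseq R) : (forall n, x n = y n) -> tequiv x y.
Proof.
by move=> e; split=> n; exists n.+1; [rewrite e|rewrite -e]; apply: tseqP.
Qed.

Lemma rep_inj R (a b : F R) : tequiv (rep a) (rep b) -> a = b.
Proof. by case=> *; apply: pom_le_anti; apply/(rep_le (repF R)). Qed.

Section Limit.
Variables (disp : Order.disp_t) (I : preorderType disp) (X : I -> rngType).
Variable f : forall i j : I, (i <= j)%O -> rngMorphism (X i) (X j).
Variables (L : rngType) (p : forall i, rngMorphism (X i) L).
Hypothesis dirI : directed I.
Hypothesis PX : forall i, P (X i).
Hypothesis sysX : @is_direct_system rng_category disp I X f.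
Hypothesis limL : @is_direct_limit rng_category disp I X f L p.

Let PL : P L := link_limit lkP dirI sysX limL PX.

Lemma Fmap_system : @is_direct_system Cu_category disp I (fun i => F (X i))
  (fun i j ij => Fmap (f ij)).
Proof.
split=> [i|i j ij|i ii a|i j k ij jk ik a].
- exact: represented_is_Cu.
- exact: Fmap_is_Cu_morphism.
- apply: rep_inj; apply: tequiv_trans (repFmap _ _) _; apply: tequiv_ext => n.
  exact: Minf_map_transition_id sysX _ _ _.
- apply: rep_inj; apply: tequiv_trans (repFmap _ _) _.
  apply: tequiv_trans (Tmap_tequiv _ (repFmap _ _)) _.
  apply: tequiv_trans (tequiv_sym (repFmap _ _)); apply: tequiv_ext => n.
  exact: Minf_map_transition sysX _ _ _ _ _ _ _.
Qed.

Lemma Fmap_cocone : @is_cocone Cu_category disp I (fun i => F (X i))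
  (fun i j ij => Fmap (f ij)) (F L) (fun i => Fmap (p i)).
Proof.
split=> [|i|i j ij a]; first exact: represented_is_Cu.
  exact: Fmap_is_Cu_morphism.
apply: rep_inj; apply: tequiv_trans (repFmap _ _) _.
apply: tequiv_trans (Tmap_tequiv _ (repFmap _ _)) _.
apply: tequiv_trans (tequiv_sym (repFmap _ _)); apply: tequiv_ext => n.
exact: Minf_map_limit limL _ _ _ _.
Qed.

(** An element way below [z] is bounded by a single matrix, a term of [z], so
the inequality between the images of [z] and [w] is used only for that term: one
relation between two matrices, which already holds at some stage. *)
Lemma Fmap_limit_le i (z' z w : F (X i)) :
  way_below z' z -> pom_le (Fmap (p i) z) (Fmap (p i) w) ->
  exists j (ij : (i <= j)%O), pom_le (Fmap (f ij) z') (Fmap (f ij) w).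
Proof.
move=> /(way_belowP (repF _) (link_interp lkP (PX i)) (link_sup lkP (R := _))).
move=> [m hm] /(rep_le (repF L)) zw.
have /(_ m)[l] : precsim (Tmap (p i) (rep z)) (Tmap (p i) (rep w)).
  apply: precsim_trans (repFmap _ _).2 (precsim_trans zw _).
  exact: (repFmap _ _).1.
move=> /(precsim1_lift dirI sysX limL)[j [ij [b [eb hb]]]].
rewrite /= -(Minf_map_limit limL ij) in eb.
have [k [jk ek]] := Minf_limit_eq dirI sysX limL eb.
have ik := le_trans ij jk; exists k, ik; apply/(rep_le (repF _)).
apply: precsim_trans (repFmap _ _).1 (precsim_trans _ (repFmap _ _).2) => n.
exists l; rewrite /= -(Minf_map_transition sysX ij jk ik (rep w l)) -ek.
apply: precsim1_trans (precsim1_map _ (hm n)) _.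
by rewrite -(Minf_map_transition sysX ij jk ik); apply: precsim1_map.
Qed.

(** Lift the terms of a chain [x] for [a] to matrices [A n] at stages [i n],
with [A n.+1] chosen after [A n] so that the link holds at its stage.
Interpolation consumes two links, so the chain of [z n], over the stage
[i n.*2.+2], lies between [A n.*2] and [A n.*2.+2], whose images in the limit
are [x n.*2] and [x n.*2.+2]. *)
Lemma Fmap_approx_exists (a : F L) : exists i z,
  approximates (fun i j ij => Fmap (f ij)) (fun i => Fmap (p i))
    (i := i) z a.
Proof.
have [x cx ax] := rep_chain (repF L) a.
have [i0 [a0 e0]] := Minf_limit_onto dirI sysX limL (x 0%N).
have [|s hs] := @dependent_choice_on {i : I & Minf (X i)}
    (fun n t => Minf_map (p (tag t)) (tagged t) = x n)
    (fun t t' => exists h : (tag t <= tag t')%O,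
       lk (Minf_map (f h) (tagged t)) (tagged t'))
    (Tagged (fun i => Minf (X i)) a0) e0.
  move=> n [i b] /= eb; have := cx n; rewrite -eb.
  move=> /(link_lift lkP dirI sysX limL)[j [ij [b' [eb' hb']]]].
  by exists (Tagged (fun i => Minf (X i)) b'); split=> //; exists ij.
pose i n := tag (s n); pose A n : Minf (X (i n)) := tagged (s n).
have pA n : Minf_map (p (i n)) (A n) = x n := (hs n).1.
have sA n : exists h : (i n <= i n.+1)%O, lk (Minf_map (f h) (A n)) (A n.+1)
  := (hs n).2.
have hz' : forall n, exists z : F (X (i n.*2.+2)),
    exists h : (i n.*2 <= i n.*2.+2)%O,
    (exists m, precsim1 (Minf_map (f h) (A n.*2)) (rep z m)) /\
    (forall k, precsim1 (rep z k) (A n.*2.+2)).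
  move=> n; have [h1 l1] := sA n.*2; have [h2 l2] := sA n.*2.+1.
  have [w cw [w1 w2]] := link_interp lkP (PX _) (link_map lkP (f h2) l1) l2.
  have [y [yw wy]] := rep_onto (repF _) cw.
  exists y, (le_trans h1 h2); split.
    have [m hm] := wy 0%N; exists m.
    by rewrite -(Minf_map_transition sysX h1 h2); apply: precsim1_trans w1 hm.
  by move=> k; have [m hm] := yw k; apply: precsim1_trans hm (w2 m).
pose z n := projT1 (cid (hz' n)).
have hz n := projT2 (cid (hz' n)).
exists (fun n => i n.*2.+2), z; split=> [n|].
  have [h [[m hm] _]] := hz n.+1; exists h.
  apply/(way_belowP (repF _) (link_interp lkP (PX _)) (link_sup lkP (R := _))).
  apply: below_term_trans (repFmap _ _).1 _ (precsim_refl _).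
  have [_ [_ below]] := hz n.
  exists m => k; apply: precsim1_trans hm; exact: precsim1_map.
apply: (tsup_is_sup (repF L)).
apply: (@tsup_equiv _ (fun n => Tmap (p _) (rep (z n))) _ x).
- by move=> n; apply: tequiv_sym; apply: repFmap.
- exact: tequiv_sym.
split=> [n k|n].
  exists n.*2.+2; rewrite -pA; apply: precsim1_map.
  by have [_ [_]] := hz n; apply.
have [h [[m hm] _]] := hz n.+1; exists n.+1, m.
apply: precsim1_trans (precsim1_map (p _) hm).
rewrite (Minf_map_limit limL) pA; apply: tseq_homo.
by rewrite -addnn leq_addr.
Qed.

Lemma Fmap_direct_limit : @is_direct_limit Cu_category disp I
  (fun i => F (X i)) (fun i j ij => Fmap (f ij)) (F L) (fun i => Fmap (p i)).
Proof.
exact: (Cu_direct_limit dirI Fmap_system Fmap_cocone Fmap_approx_exists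
  Fmap_limit_le).
Qed.

End Limit.

Lemma represented_continuous : continuous_on P F Fmap.
Proof.
move=> disp I X f L p dirI PX sysX limL; split.
  exact: Fmap_system.
exact: Fmap_direct_limit.
Qed.

End Continuity.

(** * The two semigroups *)

Lemma dense_continuous_link : continuous_link dense_rng precsim1.
Proof.
split=> //.
- move=> R D a b c ab bc.
  have [z [h1 h2]] := dense_interpolation D (precsim1_trans ab bc).
  by exists z => //; exact: tseqP.
- move=> R u _ inc; have [s hs] := tsup_exists inc.
  by exists s => //; exact: tseqP.
- by move=> *; apply: precsim1_map.
- exact: dense_rng_limit.
- exact: precsim1_lift.
Qed.

Lemma left_normal_continuous_link : continuous_link left_normal unital_below.
Proof.
split.
- by move=> R N a b c; apply: left_normal_interpolation.
- by move=> R u; apply: tsup_unital.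
- by move=> R R' phi a b [y e]; exists (Minf_map phi y); rewrite -!Minf_mapM -e.
- exact: left_normal_limit.
- exact: unital_below_lift.
Qed.

Section LambdaRep.
Variable R : rngType.

Definition Lambda_rep (a : Lambda R) : Tseq R := repr a.
Definition Ssemi_rep (a : Ssemi R) : Tseq R := repr (Sval a).

Lemma repr_add (a b : Lambda R) :
  tequiv (repr (a + b)) (Toplus (repr a) (repr b)).
Proof. exact/tequiv_sym/Lambda_repr. Qed.

Lemma Lambda_represents : represents (@precsim1 R) Lambda_rep.
Proof.
split=> //.
- exact: (Lambda_repr (Tzero R)).2.
- exact: repr_add.
- by move=> a; exists (repr a); [exact: tseqP|split; exact: precsim_refl].
- by move=> z _; exists (\pi_(Lambda R) z); apply/tequiv_sym/Lambda_repr.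
Qed.

Lemma Ssemi_represents : represents (@unital_below R) Ssemi_rep.
Proof.
split=> //.
- exact: (Lambda_repr (Tzero R)).2.
- by move=> a b; apply: repr_add.
- move=> a; have /asboolP[x cx e] := SvalP a; exists x => //.
  by rewrite /Ssemi_rep e; apply/tequiv_sym/Lambda_repr.
- move=> z cz.
  have Sz : Sclass (\pi_(Lambda R) z) by apply/asboolP; exists z.
  by exists (MkSsemi Sz); apply/tequiv_sym/Lambda_repr.
Qed.
End LambdaRep.

Lemma Lambda_map_repr (R R' : rngType) (phi : rngMorphism R R') (a : Lambda R) :
  tequiv (repr (Lambda_map phi a)) (Tmap phi (repr a)).
Proof. exact/tequiv_sym/Lambda_repr. Qed.

Theorem theoremC :
  ((forall R : rngType, dense_rng R -> is_Cu (Lambda R)) /\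
   continuous_on dense_rng (fun R : rngType => Lambda R : pomType)
     (fun (R R' : rngType) (phi : rngMorphism R R') => Lambda_map phi)) /\
  ((forall R : rngType, left_normal R -> is_Cu (Ssemi R)) /\
   continuous_on left_normal (fun R : rngType => Ssemi R : pomType)
     (fun (R R' : rngType) (phi : rngMorphism R R') => Ssemi_map phi)).
Proof.
split; split.
- move=> R; exact: (represented_is_Cu dense_continuous_link Lambda_represents).
- apply: (represented_continuous dense_continuous_link Lambda_represents).
  exact: Lambda_map_repr.
- move=> R.
  exact: (represented_is_Cu left_normal_continuous_link Ssemi_represents).
- apply: (represented_continuous left_normal_continuous_link Ssemi_represents).
  by move=> R R' phi a; apply: Lambda_map_repr.
Qed.
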